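(* Let $2\le q<\infty$ and let $q'=q/(q-1)$. Let $\Phi$ be a Young function of the form $\Phi(t)=\tilde\Phi(t^{q'})$, where $\tilde\Phi$ is another Young function, and let $\mu$ be a positive regular Borel measure on $\mathbb{C}_+$. Then $$\|\mathcal{L}\colon L^\Phi(0,\infty)\to L^q(\mathbb{C}_+,d\mu)\|^q\le K\sum_{n\in\mathbb{Z}}\Big(2^n\,\|e_n\|_{L^{\tilde\Phi^c}(0,\infty)}\Big)^{q-1}\mathcal{C}_q[\mu_n],$$ where $e_n(t)=e^{-q'2^{n-1}t}$ for $t>0$, $\tilde\Phi^c$ is the complementary Young function of $\tilde\Phi$, and $K$ is a constant depending only on $q$.
   Context: $\mathbb{C}_+=\{z\in\mathbb{C}:\operatorname{Re}z>0\}$. The Laplace transform of a function $f$ on $(0,\infty)$ is $\mathcal{L}f(z)=\int_0^\infty e^{-zt}f(t)\,dt$, $z\in\mathbb{C}_+$. The operator norm is taken to be $\infty$ if the map is not bounded. A Young function is a function $\Phi\colon[0,\infty)\to[0,\infty]$ of the form $\Phi(t)=\int_0^t\phi(s)\,ds$, where $\phi\colon[0,\infty)\to[0,\infty]$ is nondecreasing, left-continuous, and neither constantly $0$ nor constantly $+\infty$. Its complementary Young function is $\Phi^c(t)=\int_0^t\phi^c(s)\,ds$, where $\phi^c$ is the (left-continuous) generalized inverse of $\phi$, $\phi^c(s)=\inf\{t\ge0:\phi(t)\ge s\}$. For an interval $J\subseteq\mathbb{R}$, $L^\Phi(J)$ is the space of measurable $f\colon J\to\mathbb{C}$ for which $\Phi(k^{-1}|f|)$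 is integrable for some $k>0$, with norm $\|f\|_{L^\Phi}=\inf\{k>0:\int_J\Phi(k^{-1}|f(s)|)\,ds\le1\}$. For an interval $I\subset i\mathbb{R}$ with length $|I|\in(0,\infty)$, $Q_I=\{x+iy: iy\in I,\ 0<x\le|I|\}$. For a positive regular Borel measure $\mu$ on $\mathbb{C}_+$ and $\beta>0$, $\mathcal{C}_\beta[\mu]=\sup_{I}\mu(Q_I)/|I|^\beta$, the supremum over all intervals $I\subset i\mathbb{R}$. For $n\in\mathbb{Z}$ let $S_n=\{x+iy: y\in\mathbb{R},\ 2^n\le x<2^{n+1}\}$ and $\mu_n(E)=\mu(E\cap S_n)$. *)

(* Defs.v *)
From HB Require Import structures.
From mathcomp Require Import all_boot all_order all_algebra.
From mathcomp Require Import complex.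
From mathcomp Require Import all_classical all_reals all_analysis.

Set Implicit Arguments.
Unset Strict Implicit.
Unset Printing Implicit Defensive.

Import Order.TTheory GRing.Theory Num.Theory.
Import numFieldNormedType.Exports.

Local Open Scope classical_set_scope.
Local Open Scope complex_scope.
Local Open Scope ring_scope.

(* Functions that only matter on [0, +oo[ are total functions on R whose values
   at negative arguments are unconstrained and never used. *)

(* Only t > 0 is constrained in young_left_cont: there is nothing to the left
   of 0 in the domain [0, +oo[. *)
Record young_function (R : realType) := YoungFunction {
  young_density : R -> \bar R;
  young_ge0 : forall t : R, 0 <= t -> (0 <= young_density t)%E;
  young_nondecreasing : forall s t : R, 0 <= s -> s <= t ->
    (young_density s <= young_density t)%E;
  young_left_cont : forall t : R, 0 < t ->
    young_density x @[x --> t^'-] --> young_density t;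
  young_neq0 : exists2 t : R, 0 <= t & young_density t <> 0%E;
  young_neqy : exists2 t : R, 0 <= t & young_density t <> +oo%E
}.

Definition integral_from0 (R : realType) (phi : R -> \bar R) (t : R) : \bar R :=
  (\int[@lebesgue_measure R]_(s in `[0%R, t]) phi s)%E.

Definition young_eval (R : realType) (Phi : young_function R) : R -> \bar R :=
  integral_from0 (young_density Phi).

Coercion young_eval : young_function >-> Funclass.

(* ereal_inf set0 = +oo. *)
Definition generalized_inverse (R : realType) (phi : R -> \bar R) (s : R) :
    \bar R :=
  ereal_inf [set t%:E | t in [set t : R | 0 <= t /\ (s%:E <= phi t)%E]].

(* The density of a Young function is determined by its values on ]0, +oo[, and
   its generalized inverse does not depend on its value at 0, so this depends
   only on the function t |-> Phi t. *)
Definition complementary (R : realType) (Phi : young_function R) :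
    R -> \bar R :=
  integral_from0 (generalized_inverse (young_density Phi)).

Definition cmeasurable_fun (R : realType) d (T : measurableType d) (D : set T)
    (f : T -> R[i]) : Prop :=
  measurable_fun D (fun x => complex.Re (f x)) /\
  measurable_fun D (fun x => complex.Im (f x)).

Definition cintegrable (R : realType) (D : set R) (f : R -> R[i]) : Prop :=
  (@lebesgue_measure R).-integrable D (fun x => (complex.Re (f x))%:E) /\
  (@lebesgue_measure R).-integrable D (fun x => (complex.Im (f x))%:E).

Definition cintegral (R : realType) (D : set R) (f : R -> R[i]) : R[i] :=
  (\int[@lebesgue_measure R]_(x in D) complex.Re (f x)) +i*
  (\int[@lebesgue_measure R]_(x in D) complex.Im (f x)).

Definition cexp (R : realType) (z : R[i]) : R[i] :=
  (expR (complex.Re z))%:C *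
  (cos (complex.Im z) +i* sin (complex.Im z)).

Definition orlicz_space (R : realType) (Phi : R -> \bar R) (J : set R)
    (f : R -> R[i]) : Prop :=
  cmeasurable_fun J f /\
  exists2 k : R, 0 < k &
    (@lebesgue_measure R).-integrable J
      (fun s => Phi (k^-1 * Normc.normc (f s))).

Definition orlicz_norm (R : realType) (Phi : R -> \bar R) (J : set R)
    (f : R -> R[i]) : \bar R :=
  ereal_inf [set k%:E | k in [set k : R | 0 < k /\
    (\int[@lebesgue_measure R]_(s in J)
       Phi (k^-1 * Normc.normc (f s))%R <= 1)%E]].

(* For measures and topology, the complex plane is R * R, whose product
   sigma-algebra is its Borel sigma-algebra; (x, y) stands for x + iy. *)
Definition Cplus (R : realType) : set (R * R) := [set z | 0 < z.1].
Arguments Cplus : clear implicits.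

(* A Borel measure on Cplus is represented by a measure on R * R of which only
   the values on subsets of Cplus are used. Cplus being open, its relatively
   open subsets are the open sets of R * R contained in it. *)
Definition regular_on_Cplus (R : realType)
    (mu : {measure set (R * R) -> \bar R}) : Prop :=
  forall E : set (R * R), measurable E -> E `<=` Cplus R ->
    mu E = ereal_inf [set mu U | U in
             [set U : set (R * R) | [/\ open U, E `<=` U & U `<=` Cplus R]]] /\
    mu E = ereal_sup [set mu A | A in
             [set A : set (R * R) | compact A /\ A `<=` E]].

Definition laplace_kernel (R : realType) (f : R -> R[i]) (z : R * R) (t : R) :
    R[i] :=
  cexp (- ((z.1 +i* z.2) * t%:C)) * f t.

Definition laplace (R : realType) (f : R -> R[i]) (z : R * R) : R[i] :=
  cintegral `]0, +oo[ (laplace_kernel f z).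

Definition Lq_norm (R : realType) (q : R)
    (mu : {measure set (R * R) -> \bar R}) (g : R * R -> R[i]) : \bar R :=
  ((\int[mu]_(z in Cplus R) (Normc.normc (g z) `^ q)%:E) `^ q^-1)%E.

Definition Lq_space (R : realType) (q : R)
    (mu : {measure set (R * R) -> \bar R}) (g : R * R -> R[i]) : Prop :=
  cmeasurable_fun (Cplus R) g /\ (Lq_norm q mu g < +oo)%E.

(* The infimum is +oo when no bound M exists. The conditions on f also require
   the Laplace integral to converge absolutely at every point of Cplus, so that
   the default value 0 of divergent integrals plays no role. *)
Definition laplace_opnorm (R : realType) (Phi : R -> \bar R) (q : R)
    (mu : {measure set (R * R) -> \bar R}) : \bar R :=
  ereal_inf [set M%:E | M in [set M : R | 0 <= M /\
    forall f : R -> R[i], orlicz_space Phi `]0, +oo[ f ->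
      [/\ forall z, Cplus R z -> cintegrable `]0, +oo[ (laplace_kernel f z),
          Lq_space q mu (laplace f) &
          (Lq_norm q mu (laplace f) <=
             M%:E * orlicz_norm Phi `]0%R, +oo[ f)%E]]].

(* I is the set of imaginary parts of an interval of the imaginary axis. *)
Definition interval_length (R : realType) (I : set R) : \bar R :=
  @lebesgue_measure R I.

Definition carleson_box (R : realType) (I : set R) : set (R * R) :=
  [set z | I z.2 /\ 0 < z.1 <= fine (interval_length I)].

Definition carleson_const (R : realType) (beta : R)
    (nu : set (R * R) -> \bar R) : \bar R :=
  ereal_sup [set (nu (carleson_box I) *
                  ((fine (interval_length I) `^ beta)^-1)%:E)%E | I in
    [set I : set R |
      is_interval I /\ (0 < interval_length I < +oo)%E]].

Definition strip (R : realType) (n : int) : set (R * R) :=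
  [set z | 2 ^ n <= z.1 < 2 ^ (n + 1)].
Arguments strip : clear implicits.

Definition strip_restr (R : realType) (mu : set (R * R) -> \bar R) (n : int)
    (E : set (R * R)) : \bar R :=
  mu (E `&` strip R n).

Definition exp_dyadic (R : realType) (q' : R) (n : int) (t : R) : R[i] :=
  (expR (- (q' * 2 ^ (n - 1) * t)))%:C.

(* Main.v *)
Require Import Defs.
From HB Require Import structures.
From mathcomp Require Import all_boot all_order all_algebra.
From mathcomp Require Import complex.
From mathcomp Require Import all_classical all_reals all_analysis.
From mathcomp Require Import measurable_realfun ring lra zify.
Import Order.TTheory GRing.Theory Num.Theory.
Import numFieldNormedType.Exports.
Local Open Scope classical_set_scope.
Local Open Scope ring_scope.
Set Implicit Arguments.
Unset Strict Implicit.
Unset Printing Implicit Defensive.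

(** Write F for the Laplace transform of f, p = q' = q / (q - 1) and a = 2 ^ n.
    The theorem is the sum over n of the strip estimate
      int_(S_n) |F|^q dmu <= K (a * int e_n |f|^p)^(q - 1) C_q[mu_n]
    (integral_strip_le), combined with the Hoelder inequality of Orlicz spaces
    for e_n and |f|^p (orlicz_hoelder), which itself is Young's inequality
    s t <= Phi s + Phi^c t (young_inequality) integrated.

    To prove the strip estimate, cut S_n into boxes of height 2 pi a. Each of
    them lies in a Carleson box of side 2 pi a, so it has mass at most
    (2 pi a)^q C_q[mu_n] (measure_dyadic_box_le), and it suffices to bound the
    sum over the boxes of sup |F|^q by K / a * (int e_n |f|^p)^(q - 1). This is
    a discrete Hausdorff-Young inequality for the weighted function
    g t = exp (- a t / 2) f t. As the constant may depend on q, neither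
    Plancherel's formula nor complex interpolation is needed.

    At a point x + i (2 pi a k + eta) of the k-th box, the kernel is an
    oscillation of frequency 2 pi a k times exp (- a t / 2) times a slowly
    varying factor psi, and psi t is the integral over [t, +oo[ of a function
    bounded by 10 a exp (- a s / 2). By Fubini's theorem |F| is bounded on the
    whole box by quantities that do not depend on the point: averages
      H_k g = int 10 a exp (- a s / 2) |G_k s| ds,
    where G_k s is the integral over ]0, s] of g times the oscillation
    (hartley_damped_le, laplace_le_box_bound). Now H_k g <= 40 |g|_1, while
    Bessel's inequality on an interval of length at most s + 1 / a bounds the
    sum of the (G_k s)^2 (bessel_hartley), so that the sum of the (H_k g)^2 is
    at most a constant times |g|_2^2 / a. Marcinkiewicz interpolation between
    these two bounds (marcinkiewicz) gives the exponents p and q.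

    The oscillations are the functions cos + sin of 2 pi a k t, k ranging over
    the integers: they are real-valued and orthogonal on every [0, N / a], and
    cos and sin of 2 pi a k t are half-sums and half-differences of those of
    indices k and - k. *)

(** * Integrals of real-valued functions *)

Section integral_of_real_functions.
Context {d} {T : measurableType d} {R : realType} (mu : {measure set T -> \bar R}).
Context {D : set T} (mD : measurable D).
Implicit Types f g : T -> R.

Lemma ge0_integralZlR f k : measurable_fun D f -> (forall x, D x -> 0 <= f x) ->
  0 <= k ->
  (\int[mu]_(x in D) (k * f x)%:E = k%:E * \int[mu]_(x in D) (f x)%:E)%E.
Proof.
move=> mf f0 k0; under eq_integral do rewrite EFinM.
by rewrite ge0_integralZl_EFin//; exact/measurable_EFinP.
Qed.

Lemma ge0_le_integralR f g : measurable_fun D f -> measurable_fun D g ->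
  (forall x, D x -> 0 <= f x) -> (forall x, D x -> f x <= g x) ->
  (\int[mu]_(x in D) (f x)%:E <= \int[mu]_(x in D) (g x)%:E)%E.
Proof.
by move=> mf mg f0 fg; apply: ge0_le_integral => //; exact/measurable_EFinP.
Qed.

Lemma measurable_fun_ifD (b : T -> bool) f g : measurable_fun D b ->
  measurable_fun D f -> measurable_fun D g ->
  measurable_fun D (fun x => if b x then f x else g x).
Proof.
by move=> mb mf mg; apply: measurable_fun_if => //;
  [apply: measurable_funS mf|apply: measurable_funS mg] => //; exact: subIsetl.
Qed.

End integral_of_real_functions.

(** * Marcinkiewicz interpolation *)

(** A geometric sum of r-th powers, restricted to the powers of numbers below c,
    is at most a constant times c `^ r, whatever its first term and its length. *)
Lemma truncated_geometric_sum {R : realType} (r c : R) (L : nat) (M : R) :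
  0 < r -> 0 <= c -> 0 < M ->
  \sum_(m < L) (if M / 2 ^+ m <= c then (M / 2 ^+ m) `^ r else 0)
    <= (1 - 2 `^ (- r))^-1 * c `^ r.
Proof.
move=> r0 c0.
have d0 : 0 < 1 - 2 `^ (- r) :> R.
  rewrite subr_gt0 powRN invf_lt1 ?powR_gt0//.
  have := @gt0_ltr_powR R r r0 1 2; rewrite !nnegrE powR1; apply; lra.
set D := (1 - 2 `^ (- r))^-1.
have D0 : 0 < D by rewrite invr_gt0.
(* Strengthened for the induction: the sum is controlled by the smaller of M
   and c. *)
suff H : forall M, 0 < M ->
    \sum_(m < L) (if M / 2 ^+ m <= c then (M / 2 ^+ m) `^ r else 0)
      <= D * (Num.min M c) `^ r.
  move=> M0; apply: (le_trans (H _ M0)); rewrite ler_pM2l//.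
  by apply: ge0_ler_powR; rewrite ?nnegrE ?le_min ?(ltW r0) ?(ltW M0)//= ge_min lexx orbT.
elim: L => [|L IH] {}M M0; first by rewrite big_ord0 mulr_ge0 ?powR_ge0 ?ltW.
rewrite big_ord_recl/= expr0 divr1.
have M20 : 0 < M / 2 by rewrite divr_gt0.
have := IH _ M20.
set S := \sum_(_ < _) _ => HS.
under eq_bigr do rewrite /bump/= add1n exprS invfM mulrA.
rewrite -/S; case: (leP M c) => [Mc|cM].
- rewrite min_l// in HS; last by rewrite (le_trans _ Mc)// ler_pdivrMr//; lra.
  have -> : D * M `^ r = M `^ r + D * (M / 2) `^ r.
    rewrite powRM ?ltW// ?invr_ge0// -(@powR_inv1 _ 2)// -powRrM mulN1r /D.
    by field; rewrite lt0r_neq0.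
  by rewrite lerD2l.
- rewrite add0r (le_trans HS)// ler_pM2l//.
  apply: ge0_ler_powR; rewrite ?nnegrE ?le_min ?(ltW r0) ?(ltW M20)//=.
  by rewrite ge_min lexx orbT.
Qed.

Section marcinkiewicz.
Context {R : realType}.
Notation mu := (@lebesgue_measure R).

(** The constant of the interpolation below; it blows up as q tends to 2. *)
Definition marcinkiewicz_const (q : R) : R :=
  2 `^ q * 2 `^ (q - 2) * (1 - 2 `^ (- (q - 2)))^-1.

(** Interpolation between an L^1 to l^oo bound of norm C1 and an L^2 to l^2 bound
    of squared norm C2, in a form that mentions no operator: a k stands for the
    modulus of the k-th coordinate of the image of g, and b k s for that of the
    image of g truncated to {|g| <= s}. *)
Lemma marcinkiewicz (q C1 C2 P : R) (D : set R) (g : R -> R)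
    (I : eqType) (A : seq I) (a : I -> R) (b : I -> R -> R) :
  2 < q -> 0 < C1 -> 0 < C2 -> 0 < P -> measurable D -> measurable_fun D g ->
  (\int[mu]_(t in D) (`|g t| `^ (q / (q - 1)))%:E <= P%:E)%E ->
  (forall k, k \in A -> 0 <= a k) ->
  (forall k (s : R), k \in A -> 0 < s ->
    ((a k)%:E <= C1%:E * \int[mu]_(t in D) (if s < `|g t| then `|g t| else 0)%:E
       + (b k s)%:E)%E) ->
  (forall s : R, 0 < s -> (\sum_(k <- A) ((b k s) ^+ 2)%:E <=
    C2%:E * \int[mu]_(t in D) (if `|g t| <= s then g t ^+ 2 else 0)%:E)%E) ->
  \sum_(k <- A) a k `^ q
    <= marcinkiewicz_const q * C1 `^ (q - 2) * C2 * P `^ (q - 1).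
Proof.
move=> q2 C10 C20 P0 mD mg gP a0 ab bb.
have q0 : 0 < q by lra.
have q10 : 0 < q - 1 by lra.
have q20 : 0 < q - 2 by lra.
set p := q / (q - 1) in gP.
have pq : (p - 1) * (q - 1) = 1 by rewrite /p; field; rewrite lt0r_neq0.
have p1 : 0 < p - 1 by rewrite -(pmulr_lgt0 _ q10) pq.
have mgp : measurable_fun D (fun t => `|g t| `^ p).
  by apply: (measurableT_comp (measurable_powR _)); exact: measurableT_comp.
have mng : measurable_fun D (fun t => `|g t|) by exact: measurableT_comp.
pose s (l : R) := (2 * C1 * P / l) `^ (q - 1).
have K0 : 0 < 2 * C1 * P by rewrite !mulr_gt0.
have s0 (l : R) : 0 < l -> 0 < s l by move=> l0; rewrite powR_gt0 ?divr_gt0.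
have sp (l : R) : 0 < l -> s l `^ (p - 1) = 2 * C1 * P / l.
  move=> l0; rewrite /s -powRrM [(q - 1) * _]mulrC pq powRr1//.
  by rewrite ltW// divr_gt0.
(* The part of g above the level s l contributes at most l / 2. *)
have tail (l : R) : 0 < l ->
    (C1%:E * \int[mu]_(t in D) (if (s l < `|g t|)%R then `|g t| else 0)%:E
       <= (l / 2)%:E)%E.
  move=> l0.
  have H : (\int[mu]_(t in D) (if (s l < `|g t|)%R then `|g t| else 0)%:E <=
     ((s l `^ (p - 1))^-1 * P)%:E)%E.
    rewrite EFinM; apply: (@le_trans _ _ (((s l `^ (p - 1))^-1)%:E *
         \int[mu]_(t in D) (`|g t| `^ p)%:E)%E); last first.
      by rewrite lee_wpmul2l// lee_fin invr_ge0 powR_ge0.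
    rewrite -ge0_integralZlR//; last by rewrite invr_ge0 powR_ge0.
    apply: ge0_le_integralR => //.
    - apply: measurable_fun_ifD => //; exact: measurable_fun_ltr.
    - by apply: measurable_funM.
    - by move=> t _; case: ifP.
    move=> t _; case: ifP => st; last first.
      by rewrite mulr_ge0 ?invr_ge0 ?powR_ge0.
    rewrite ler_pdivlMl ?powR_gt0 ?divr_gt0//.
    rewrite (_ : p = 1 + (p - 1)); last by ring.
    have gt0 : 0 < `|g t| := lt_trans (s0 _ l0) st.
    rewrite (@powRD _ _ 1); last by rewrite (lt0r_neq0 gt0) implybT.
    rewrite powRr1// mulrC ler_pM2l// addrAC subrr add0r.
    by apply: ge0_ler_powR; rewrite ?nnegrE ?(ltW p1) ?powR_ge0 ?(ltW st).
  apply: (le_trans (lee_wpmul2l _ H)); first by rewrite lee_fin ltW.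
  rewrite -EFinM lee_fin sp// le_eqVlt; apply/orP; left; apply/eqP.
  by field; rewrite !lt0r_neq0.
(* Hence the truncated part carries at least half of a k as soon as l < a k. *)
have ab2 k (l : R) : k \in A -> 0 < l -> l < a k -> a k ^+ 2 <= 4 * b k (s l) ^+ 2.
  move=> kA l0 la.
  have : ((a k)%:E <= (l / 2)%:E + (b k (s l))%:E)%E.
    by apply: (le_trans (ab _ _ kA (s0 _ l0))); rewrite leeD2r// tail.
  rewrite -EFinD lee_fin => H; have := a0 _ kA; nra.
(* Dyadic levels M / 2 ^+ m below an upper bound M of the a k. *)
pose M := 1 + \sum_(k <- A) a k.
have M0 : 0 < M by rewrite ltr_pwDl// big_seq sumr_ge0.
have aM k : k \in A -> a k < M.
  move=> kA; rewrite /M (big_rem _ kA)/= addrA addrAC ltr_pwDl//.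
    rewrite ltr_pwDl// big_seq sumr_ge0// => j jA.
    by rewrite a0// (mem_rem jA).
pose lev m : R := M / 2 / 2 ^+ m.
have lev0 m : 0 < lev m by rewrite !divr_gt0// exprn_gt0.
have levM m : lev m = M / 2 ^+ m.+1.
  by rewrite /lev exprS; field; rewrite expf_neq0.
have exL (B : seq I) : exists L, forall k, k \in B -> 0 < a k -> M / 2 ^+ L < a k.
  elim: B => [|k B [L IH]]; first by exists 0%N.
  have [N HN] : exists N, 0 < a k -> M / 2 ^+ N < a k.
    case: (leP (a k) 0) => [ak|ak]; first by exists 0%N.
    exists (Num.truncn (M / a k)).+1 => _.
    rewrite ltr_pdivrMr ?exprn_gt0// mulrC -ltr_pdivrMr//.
    apply: (lt_le_trans (truncnS_gt _)).
    by rewrite -natrX ler_nat ltnW// ltn_expl.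
  exists (maxn L N) => j; rewrite inE => /orP[/eqP ->|jA] aj.
    apply: le_lt_trans (HN aj); rewrite ler_pM2l// lef_pV2 ?posrE ?exprn_gt0//.
    by rewrite ler_weXn2l ?ler1n// leq_maxr.
  apply: le_lt_trans (IH _ jA aj); rewrite ler_pM2l// lef_pV2 ?posrE ?exprn_gt0//.
  by rewrite ler_weXn2l ?ler1n// leq_maxl.
have [L HL] := exL A.
have akq k : k \in A -> a k `^ q <=
    \sum_(m < L) 2 `^ q * (lev m `^ (q - 2) * b k (s (lev m)) ^+ 2).
  move=> kA; have := a0 _ kA; rewrite le_eqVlt => /orP[/eqP <-|ak0].
    rewrite powR0 ?lt0r_neq0// sumr_ge0// => m _.
    by rewrite (mulr_ge0 (powR_ge0 _ _))// (mulr_ge0 (powR_ge0 _ _))// sqr_ge0.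
  have [m Lm /andP[m1 m2]] : exists2 m, (m < L)%N & lev m < a k <= 2 * lev m.
    have : exists m, M / 2 ^+ m < a k by exists L; exact: HL.
    move=> /ex_minnP[[|m] Hm Hmin].
      by move: Hm; rewrite expr0 divr1 => /(lt_trans (aM _ kA)); rewrite ltxx.
    exists m; first by apply: Hmin; exact: HL.
    rewrite levM Hm/= -levM leNgt; apply/negP => H.
    suff /Hmin : M / 2 ^+ m < a k by rewrite ltnn.
    by move: H; rewrite /lev; congr (_ < _); field; rewrite expf_neq0.
  rewrite (bigD1 (Ordinal Lm))//= -[leLHS]addr0 lerD//; last first.
    rewrite sumr_ge0// => j _.
    by rewrite (mulr_ge0 (powR_ge0 _ _))// (mulr_ge0 (powR_ge0 _ _))// sqr_ge0.
  have qE x : 0 < x -> x `^ q = x ^+ 2 * x `^ (q - 2).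
    move=> x0; rewrite -(@powR_mulrn _ x 2) ?(ltW x0)// -powRD ?(lt0r_neq0 x0) ?implybT//.
    by congr (_ `^ _); ring.
  rewrite (qE _ ak0) (qE 2)//.
  have H1 : a k `^ (q - 2) <= 2 `^ (q - 2) * lev m `^ (q - 2).
    rewrite -powRM// ?(ltW (lev0 _))//; apply: ge0_ler_powR;
      rewrite ?nnegrE ?(ltW q20) ?(ltW ak0)//.
    by rewrite mulr_ge0// ltW.
  have H2 := ab2 _ _ kA (lev0 m) m1.
  apply: (le_trans (ler_pM _ _ H2 H1)); rewrite ?sqr_ge0 ?powR_ge0//.
  by rewrite le_eqVlt; apply/orP; left; apply/eqP; ring.
rewrite -lee_fin.
apply: (@le_trans _ _ (\sum_(m < L) (2 `^ q * lev m `^ (q - 2))%:E *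
   (C2%:E * \int[mu]_(t in D) (if (`|g t| <= s (lev m))%R then g t ^+ 2 else 0)%:E))%E).
  apply: (@le_trans _ _ (\sum_(m < L) (2 `^ q * lev m `^ (q - 2))%:E *
      (\sum_(k <- A) ((b k (s (lev m))) ^+ 2)%:E))%E); last first.
    apply: lee_sum => m _; rewrite lee_wpmul2l ?lee_fin ?mulr_ge0 ?powR_ge0//.
    exact/bb/s0.
  rewrite [leRHS](eq_bigr (fun m : 'I_L => (2 `^ q * lev m `^ (q - 2) *
    \sum_(k <- A) b k (s (lev m)) ^+ 2)%:E)); last first.
    by move=> m _; rewrite sumEFin -EFinM.
  rewrite sumEFin lee_fin.
  under [leRHS]eq_bigr do rewrite mulr_sumr.
  rewrite exchange_big/= big_seq [leRHS]big_seq; apply: ler_sum => k kA.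
  by apply: (le_trans (akq _ kA)); apply: ler_sum => m _; rewrite mulrA.
pose h m t : R := if `|g t| <= s (lev m) then g t ^+ 2 else 0.
have mh m : measurable_fun D (h m).
  apply: measurable_fun_ifD => //; first exact: measurable_fun_ler.
  exact: measurable_funX.
have h0 m t : 0 <= h m t by rewrite /h; case: ifP; rewrite ?sqr_ge0.
pose w m : R := 2 `^ q * lev m `^ (q - 2) * C2.
have w0 m : 0 <= w m by rewrite !mulr_ge0 ?powR_ge0// ltW.
have mwh m : measurable_fun D (fun t => (w m * h m t)%:E).
  by apply/measurable_EFinP; exact: measurable_funM.
rewrite (eq_bigr (fun m : 'I_L => \int[mu]_(t in D) (w m * h m t)%:E)%E); last first.
  by move=> m _; rewrite muleA -EFinM -/(w m)
    (ge0_integralZlR mu mD (mh m) (fun t _ => h0 m t) (w0 m)).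
rewrite -(ge0_integral_sum mu mD (f := fun (m : 'I_L) t => (w m * h m t)%:E));
  [|by move=> m; exact: mwh|by move=> m t _; rewrite lee_fin mulr_ge0].
pose K := marcinkiewicz_const q * C1 `^ (q - 2) * C2 * P `^ (q - 2).
have d0 : 0 < 1 - 2 `^ (- (q - 2)) :> R.
  rewrite subr_gt0 powRN invf_lt1 ?powR_gt0//.
  have := @gt0_ltr_powR R (q - 2) q20 1 2; rewrite !nnegrE powR1; apply; lra.
have K00 : 0 <= K by rewrite !mulr_ge0 ?powR_ge0 ?invr_ge0 ?(ltW d0) ?(ltW C20).
rewrite (_ : _ * P `^ (q - 1) = K * P); last first.
  rewrite /K -[RHS]mulrA; congr (_ * _).
  rewrite -[X in _ = _ * X](powRr1 (ltW P0)) -powRD ?(lt0r_neq0 P0) ?implybT//.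
  by congr (_ `^ _); ring.
apply: (@le_trans _ _ (K%:E * \int[mu]_(t in D) (`|g t| `^ p)%:E)%E); last first.
  by rewrite [leRHS]EFinM; apply: lee_wpmul2l; rewrite ?lee_fin.
rewrite -ge0_integralZlR//.
under eq_integral do rewrite sumEFin.
apply: ge0_le_integralR => //.
- by apply: measurable_sum => m; exact: (measurable_funM (measurable_cst _) (mh m)).
- exact: (measurable_funM (measurable_cst _) mgp).
- by move=> t _; apply: sumr_ge0 => m _; rewrite mulr_ge0.
move=> t _.
have [g0|gn0] := eqVneq (g t) 0.
  rewrite big1; first exact: (mulr_ge0 K00 (powR_ge0 _ _)).
  move=> m _.
  by rewrite /h g0 expr0n; case: ifP; rewrite mulr0.
have ag0 : 0 < `|g t| by rewrite normr_gt0.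
pose c := 2 * C1 * P * `|g t| `^ (1 - p).
have c0 : 0 <= c by rewrite mulr_ge0 ?powR_ge0// ltW.
(* The levels m that contribute at t are those with lev m <= c. *)
have le_c m : `|g t| <= s (lev m) -> lev m <= c.
  move=> gs; rewrite /c (_ : 1 - p = - (p - 1)); last by ring.
  rewrite powRN ler_pdivlMr ?powR_gt0// mulrC -ler_pdivlMr// -(sp _ (lev0 _)).
  by apply: ge0_ler_powR; rewrite ?nnegrE ?(ltW p1) ?(ltW (s0 _ _)).
have := @truncated_geometric_sum R (q - 2) c L (M / 2) q20 c0 (divr_gt0 M0 (ltr0Sn _ 1)).
set S := \sum_(_ < _) _ => HS.
have wg0 : 0 <= 2 `^ q * C2 * `|g t| ^+ 2.
  by rewrite mulr_ge0 ?sqr_ge0// mulr_ge0 ?powR_ge0// ltW.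
apply: (@le_trans _ _ (2 `^ q * C2 * `|g t| ^+ 2 * S)).
  rewrite /S mulr_sumr; apply: ler_sum => m _; rewrite -/(lev m) /h.
  case: ifP => [/le_c ->|_]; last first.
    by rewrite mulr0; apply: mulr_ge0 => //; case: ifP => _; rewrite ?powR_ge0.
  by rewrite /w real_normK ?num_real// le_eqVlt; apply/orP; left; apply/eqP; ring.
apply: (le_trans (ler_wpM2l wg0 HS)).
rewrite /c powRM ?powR_ge0 ?(ltW K0)// powRM ?(ltW P0) ?mulr_ge0 ?(ltW C10)// powRM ?(ltW C10)//.
rewrite -powRrM (_ : `|g t| `^ p = `|g t| ^+ 2 * `|g t| `^ ((1 - p) * (q - 2))); last first.
  rewrite -(@powR_mulrn _ _ 2)// -powRD ?(lt0r_neq0 ag0) ?implybT//.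
  by congr (_ `^ _); rewrite (_ : (1 - p) * (q - 2) = (p - 1) - (p - 1) * (q - 1)); [rewrite pq|]; ring.
by rewrite /K /marcinkiewicz_const le_eqVlt; apply/orP; left; apply/eqP; ring.
Qed.
End marcinkiewicz.

(** * Integrals of derivatives and exponentials *)

Section calculus.
Context {R : realType}.
Notation mu := (@lebesgue_measure R).
Implicit Types (a b c l t : R) (f F : R -> R).

Lemma continuous_of_is_derive F f : (forall x, is_derive x (1:R) F (f x)) -> continuous F.
Proof.
move=> dF x; apply: differentiable_continuous; apply/derivable1_diffP.
by have [] := dF x.
Qed.

Lemma integral_is_derive F f a b : a < b -> (forall x, is_derive x (1:R) F (f x)) ->
  continuous f ->
  (\int[mu]_(x in `[a, b]) (f x)%:E)%E = (F b - F a)%:E.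
Proof.
move=> ab dF cf; have cF := continuous_of_is_derive dF.
rewrite (continuous_FTC2 (F := F) ab).
- by rewrite EFinB.
- exact: continuous_subspaceT.
- split.
  + by move=> x _; have [] := dF x.
  + exact/cvg_at_right_filter/cF.
  + exact/cvg_at_left_filter/cF.
- by move=> x _; rewrite derive1E; apply: derive_val.
Qed.

(** Fundamental theorem of calculus on a half-line, for nonnegative integrands. *)
Lemma ge0_integral_is_derive_y F f a l : (forall x, is_derive x (1:R) F (f x)) ->
  continuous f -> (forall x, a <= x -> 0 <= f x) -> F x @[x --> +oo] --> l ->
  (\int[mu]_(x in `[a, +oo[) (f x)%:E)%E = (l - F a)%:E.
Proof.
move=> dF cf f0 Fl; have cF := continuous_of_is_derive dF.
rewrite (ge0_continuous_FTC2y (F := F) (l := l) f0) ?EFinB//.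
- exact: continuous_subspaceT.
- exact/cvg_at_right_filter/cF.
- by move=> x _; rewrite derive1E; apply: derive_val.
Qed.

Lemma is_derive_cosM c x : is_derive x (1:R) (fun t => cos (c * t)) (- (c * sin (c * x))).
Proof.
have H : is_derive x (1:R) (fun t => c * t) c.
  by apply: is_derive_eq; rewrite scaler1.
by apply: is_derive_eq; rewrite /GRing.scale/=; ring.
Qed.

Lemma is_derive_sinM c x : is_derive x (1:R) (fun t => sin (c * t)) (c * cos (c * x)).
Proof.
have H : is_derive x (1:R) (fun t => c * t) c.
  by apply: is_derive_eq; rewrite scaler1.
by apply: is_derive_eq; rewrite /GRing.scale/=; ring.
Qed.

Lemma is_derive_expRN c x :
  is_derive x (1:R) (fun t => expR (- (c * t))) (- (c * expR (- (c * x)))).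
Proof.
have H : is_derive x (1:R) (fun t => - (c * t)) (- c).
  by apply: is_derive_eq; rewrite scaler1.
by apply: is_derive_eq; rewrite /GRing.scale/=; ring.
Qed.

Lemma cvg_expRN_y c : 0 < c -> expR (- (c * t)) @[t --> +oo] --> (0:R).
Proof.
move=> c0; rewrite (_ : (fun t => _) = (fun z => expR (- z)) \o (fun z => c * z))//.
apply: (@cvg_comp _ _ _ _ _ _ (pinfty_nbhs R)); last exact: cvgr_expR.
exact: gt0_cvgMry.
Qed.

Lemma continuous_expRN c : continuous (fun t => expR (- (c * t))).
Proof. exact: (continuous_of_is_derive (is_derive_expRN c)). Qed.

Lemma integral_expRN c t : 0 < c ->
  (\int[mu]_(s in `[t, +oo[) (expR (- (c * s)))%:E)%E = (c^-1 * expR (- (c * t)))%:E.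
Proof.
move=> c0.
have dF x : is_derive x (1:R) (fun x => - c^-1 * expR (- (c * x))) (expR (- (c * x))).
  have H := is_derive_expRN c x.
  by apply: is_derive_eq; rewrite /GRing.scale/=; field; rewrite lt0r_neq0.
have l0 : (- c^-1 * expR (- (c * x))) @[x --> +oo] --> (0:R).
  by rewrite -[X in _ --> X](mulr0 (- c^-1)); apply: cvgM; [exact: cvg_cst|exact: cvg_expRN_y].
rewrite (ge0_integral_is_derive_y dF (@continuous_expRN c) _ l0).
  by congr EFin; ring.
by move=> x _; rewrite expR_ge0.
Qed.

Lemma sin_2pi_int (m : int) : sin (2 * pi * m%:~R) = 0 :> R.
Proof.
have H (n : nat) : sin (2 * pi * n%:R) = 0 :> R.
  have := periodicn (@sinD2pi R) n 0; rewrite sin0 add0r => <-.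
  by congr sin; rewrite -[RHS]mulr_natr -[pi *+ 2]mulr_natr mulrC; ring.
case: m => n; first exact: H.
by rewrite NegzE mulrNz mulrN sinN -pmulrn H oppr0.
Qed.

Lemma cos_2pi_int (m : int) : cos (2 * pi * m%:~R) = 1 :> R.
Proof.
have H (n : nat) : cos (2 * pi * n%:R) = 1 :> R.
  have := periodicn (@cosD2pi R) n 0; rewrite cos0 add0r => H; rewrite -[RHS]H.
  by congr cos; rewrite -[RHS]mulr_natr -[pi *+ 2]mulr_natr mulrC; ring.
case: m => n; first exact: H.
by rewrite NegzE mulrNz mulrN cosN -pmulrn H.
Qed.

End calculus.

(** * Integrability of real-valued functions *)

Section integrable_of_real_functions.
Context {d} {T : measurableType d} {R : realType} (mu : {measure set T -> \bar R}).
Context {D : set T} (mD : measurable D).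
Implicit Types f g : T -> R.

Lemma le_integrableR f g : measurable_fun D f ->
  (forall x, D x -> `|f x| <= g x) -> mu.-integrable D (EFin \o g) ->
  mu.-integrable D (EFin \o f).
Proof.
move=> mf fg; apply: le_integrable => //; first exact/measurable_EFinP.
by move=> x Dx; rewrite /= lee_fin (le_trans (fg _ Dx))// ler_norm.
Qed.

Lemma ge0_integrableR f : measurable_fun D f -> (forall x, D x -> 0 <= f x) ->
  (\int[mu]_(x in D) (f x)%:E < +oo)%E -> mu.-integrable D (EFin \o f).
Proof.
move=> mf f0 foo; apply/integrableP; split; first exact/measurable_EFinP.
rewrite (eq_integral (fun x => (f x)%:E))// => x /set_mem Dx.
by rewrite /= ger0_norm// f0.
Qed.

Lemma integrable_cstR (c : R) : (mu D < +oo)%E -> mu.-integrable D (EFin \o cst c).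
Proof.
move=> Doo; apply: measurable_bounded_integrable => //.
by exists `|c|; split; [exact: num_real|move=> M cM x _ /=; exact: ltW].
Qed.

Lemma integrable_of_sqr f : (mu D < +oo)%E -> measurable_fun D f ->
  (\int[mu]_(x in D) (f x ^+ 2)%:E < +oo)%E -> mu.-integrable D (EFin \o f).
Proof.
move=> Doo mf f2.
apply: (@le_integrableR _ (fun x => 1 + f x ^+ 2)) => //.
  by move=> x _; rewrite -real_normK ?num_real//; have := normr_ge0 (f x); nra.
rewrite (_ : _ \o _ = (EFin \o cst 1%R) \+ (EFin \o (fun x => (f x ^+ 2)%R)))%E; last exact/funext.
apply: integrableD => //; first exact: integrable_cstR.
by apply: ge0_integrableR => //; [exact: measurable_funX|move=> x _; rewrite sqr_ge0].
Qed.

End integrable_of_real_functions.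

(** * Bessel's inequality for the Hartley system *)

Section hartley.
Context {R : realType}.
Notation mu := (@lebesgue_measure R).
Implicit Types (a s t : R) (j k : int) (g : R -> R).

(** The function cas = cos + sin at frequency a k. *)
Definition hartley a k t : R :=
  cos (2 * pi * a * k%:~R * t) + sin (2 * pi * a * k%:~R * t).

Lemma continuous_hartley a k : continuous (hartley a k).
Proof.
move=> x; apply: continuousD.
  exact: (continuous_of_is_derive (@is_derive_cosM R _)).
exact: (continuous_of_is_derive (@is_derive_sinM R _)).
Qed.

Lemma measurable_hartley a k (D : set R) : measurable_fun D (hartley a k).
Proof.
by apply: measurable_funTS; apply: continuous_measurable_fun; exact: continuous_hartley.
Qed.

Lemma hartley_le2 a k t : `|hartley a k t| <= 2.
Proof.
apply: (le_trans (ler_normD _ _)); have := cos_max (2 * pi * a * k%:~R * t).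
have := sin_max (2 * pi * a * k%:~R * t); lra.
Qed.

(** Orthogonality over N periods. *)
Lemma integral_hartleyM a (N : nat) j k : 0 < a -> (0 < N)%N ->
  (\int[mu]_(t in `[0%R, (N%:R / a)%R]) (hartley a j t * hartley a k t)%R%:E)%E =
    (if j == k then N%:R / a else 0)%R%:E.
Proof.
move=> a0 N0; set L := N%:R / a.
have L0 : 0 < L by rewrite divr_gt0// ltr0n.
pose al := 2 * pi * a * (j - k)%:~R; pose be := 2 * pi * a * (j + k)%:~R.
have eE : (fun t => hartley a j t * hartley a k t) = (fun t => cos (al * t) + sin (be * t)).
  apply/funext => t; rewrite /hartley /al /be.
  have -> : 2 * pi * a * (j - k)%:~R * t =
      2 * pi * a * j%:~R * t - 2 * pi * a * k%:~R * t by rewrite rmorphB; ring.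
  have -> : 2 * pi * a * (j + k)%:~R * t =
      2 * pi * a * j%:~R * t + 2 * pi * a * k%:~R * t by rewrite rmorphD; ring.
  by rewrite cosB sinD; ring.
have wL (m : int) : 2 * pi * a * m%:~R * L = 2 * pi * (m * N)%:~R.
  rewrite /L intrM -pmulrn; field; exact: lt0r_neq0.
have zero (m : int) : 2 * pi * a * m%:~R = 0 -> m = 0.
  have w0 : 0 < 2 * pi * a by rewrite !mulr_gt0// pi_gt0.
  by move/eqP; rewrite mulf_eq0 (gt_eqF w0)/= intr_eq0 => /eqP.
have aL : j - k = 0 -> al = 0 by move=> jk; rewrite /al jk mulr0z mulr0.
(* The convention 0^-1 = 0 makes this a primitive also when be = 0. *)
pose F t := (if j == k then t else al^-1 * sin (al * t)) - be^-1 * cos (be * t).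
have dF x : is_derive x (1:R) F (cos (al * x) + sin (be * x)).
  have Hs := is_derive_sinM al x; have Hc := is_derive_cosM be x.
  have -> : cos (al * x) + sin (be * x) =
     (if j == k then 1 else cos (al * x)) - (be^-1 * - (be * sin (be * x))).
    have -> : cos (al * x) = if j == k then 1 else cos (al * x).
      case: eqP => // jk; rewrite aL ?mul0r ?cos0//; by rewrite jk subrr.
    have [->|be0] := eqVneq be 0; first by rewrite !mul0r sin0; case: ifP => _; ring.
    by case: ifP => _; field.
  rewrite /F; case: eqP => jk.
    by apply: is_derive_eq; rewrite /GRing.scale/=; ring.
  have al0 : al != 0.
    by apply/eqP => /zero/eqP; rewrite subr_eq0 => /eqP.
  by apply: is_derive_eq; rewrite /GRing.scale/= mulKf.
have cf : continuous (fun t => cos (al * t) + sin (be * t)).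
  by rewrite -eE => x; apply: continuousM; exact: continuous_hartley.
have eEt t : hartley a j t * hartley a k t = cos (al * t) + sin (be * t).
  exact: (congr1 (fun f : R -> R => f t) eE).
under eq_integral do rewrite eEt.
rewrite (integral_is_derive L0 dF cf) /F; congr EFin.
rewrite !mulr0 sin0 cos0 /al /be !wL cos_2pi_int sin_2pi_int.
by case: ifP => _; ring.
Qed.

End hartley.

Section bessel.
Context {R : realType}.
Notation mu := (@lebesgue_measure R).
Implicit Types (a s t : R) (j k : int) (g : R -> R).

(** The k-th coefficient of g restricted to ]0, s]. *)
Definition hartley_coef a k g s : R :=
  \int[mu]_(t in `]0, s]) (hartley a k t * g t).

Lemma lty_measure_oc s : (mu `]0%R, s] < +oo)%E.
Proof. by rewrite lebesgue_measure_itv/=; case: ifP => _; rewrite -?EFinB ltry. Qed.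

Lemma integrable_hartleyM a k g (D : set R) : measurable D ->
  mu.-integrable D (EFin \o g) ->
  mu.-integrable D (EFin \o (fun t => hartley a k t * g t)).
Proof.
move=> mD ig; have mg : measurable_fun D g by apply/measurable_EFinP; apply: measurable_int ig.
apply: (@le_integrableR _ _ _ mu D mD _ (fun t => 2 * `|g t|)).
- by apply: measurable_funM => //; exact: measurable_hartley.
- by move=> x _; rewrite normrM ler_wpM2r// hartley_le2.
- have := @integrableZl _ _ _ mu D mD 2 _ (integrable_abse ig).
  by apply: eq_integrable => // x _; rewrite /= EFinM.
Qed.

(** Bessel's inequality over an interval of N periods containing ]0, s]; both
    sides are extended reals, and g need not be square integrable. *)
Lemma bessel_hartley a (N : nat) s g (A : seq int) : 0 < a -> (0 < N)%N ->
  s <= N%:R / a -> uniq A -> measurable_fun setT g ->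
  (\sum_(k <- A) (hartley_coef a k g s ^+ 2)%:E <=
     (N%:R / a)%:E * \int[mu]_(t in `]0%R, s]) (g t ^+ 2)%:E)%E.
Proof.
move=> a0 N0; set L := N%:R / a => sL uA mgT.
have L0 : 0 < L by rewrite divr_gt0// ltr0n.
have [->|Ioo] := eqVneq (\int[mu]_(t in `]0%R, s]) (g t ^+ 2)%:E)%E +oo%E.
  by rewrite gt0_muley ?lte_fin// leey.
pose D : set R := `]0, s]%classic.
have mD : measurable (D : set (measurableTypeR R)) by exact: measurable_itv.
have mg : measurable_fun D g by exact: measurable_funTS.
have Dfin : (mu D < +oo)%E by exact: lty_measure_oc.
have I2 : (\int[mu]_(t in D) (g t ^+ 2)%:E < +oo)%E by rewrite ltey.
have ig2 : mu.-integrable D (EFin \o (fun t => g t ^+ 2)).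
  by apply: ge0_integrableR => //; [exact: measurable_funX|move=> x _; rewrite sqr_ge0].
have ig : mu.-integrable D (EFin \o g) by exact: integrable_of_sqr.
pose c k := hartley_coef a k g s.
have cE k : (c k)%:E = (\int[mu]_(t in D) (hartley a k t * g t)%:E)%E.
  rewrite /c /hartley_coef /Rintegral fineK//.
  by apply: integrable_fin_num => //; exact: integrable_hartleyM.
(* The sum of the squares of the coefficients is the pairing of g with its
   projection S, and L times it is the square norm of S. *)
pose S t := \sum_(k <- A) c k * hartley a k t.
have ckg k : mu.-integrable D (fun t => (c k)%:E * (hartley a k t * g t)%:E)%E.
  by apply: integrableZl => //; exact: integrable_hartleyM.
have SE : (\sum_(k <- A) (c k ^+ 2)%:E = \int[mu]_(t in D) (g t * S t)%:E)%E.
  rewrite (eq_bigr (fun k => \int[mu]_(t in D) ((c k)%:E * (hartley a k t * g t)%:E))%E).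
    rewrite -integral_sum//; apply: eq_integral => t _.
    under eq_bigr do rewrite -EFinM.
    by rewrite sumEFin /S mulr_sumr; congr EFin; apply: eq_bigr => k _; ring.
  by move=> k _; rewrite expr2 EFinM {2}cE integralZl//; exact: integrable_hartleyM.
have mSf : measurable_fun setT S.
  by apply: measurable_sum => k; apply: measurable_funM => //; exact: measurable_hartley.
have S2E t : (S t ^+ 2)%:E = \sum_(j <- A) \sum_(k <- A)
    ((c j * c k)%:E * (hartley a j t * hartley a k t)%:E)%E.
  rewrite expr2 /S mulr_suml -sumEFin; apply: eq_bigr => j _.
  rewrite mulr_sumr -sumEFin; apply: eq_bigr => k _.
  by rewrite -EFinM; congr EFin; ring.
have ihh j k : mu.-integrable `[0%R, L]%classic (EFin \o (fun t => hartley a j t * hartley a k t)).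
  apply: continuous_compact_integrable; first exact: segment_compact.
  apply: continuous_subspaceT => x; apply: continuousM; exact: continuous_hartley.
have ihc (x : R) j k : mu.-integrable `[0%R, L]%classic
    (fun t => x%:E * (hartley a j t * hartley a k t)%:E)%E.
  by apply: (@integrableZl _ _ _ mu _ _ x _ (ihh j k)); exact: measurable_itv.
have ihhE (x : R) j k : (\int[mu]_(t in `[0%R, L]) (x%:E * (hartley a j t * hartley a k t)%:E) =
    (x * (if j == k then L else 0))%R%:E)%E.
  rewrite integralZl//; last exact: ihh.
  exact: (congr1 (fun z => x%:E * z)%E (integral_hartleyM j k a0 N0)).
have S2int : (\int[mu]_(t in `[0%R, L]) (S t ^+ 2)%:E = (L * \sum_(k <- A) c k ^+ 2)%:E)%E.
  under eq_integral do rewrite S2E.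
  rewrite integral_sum//; last first.
    by move=> j; apply: integrable_sum => // k _; exact: ihc.
  rewrite mulr_sumr -sumEFin big_seq [RHS]big_seq; apply: eq_bigr => j jA.
  rewrite integral_sum////.
  rewrite (bigD1_seq j)//= big1 ?adde0; last first.
    by move=> k kj; rewrite ihhE eq_sym (negbTE kj) mulr0.
  by rewrite ihhE eqxx; congr EFin; ring.
have iS2 : mu.-integrable `[0%R, L]%classic (EFin \o (fun t => S t ^+ 2)).
  apply: ge0_integrableR => //; first exact: (measurable_funTS (measurable_funX 2 mSf)).
    by move=> t _; rewrite sqr_ge0.
  by rewrite S2int ltry.
have DL : D `<=` `[0%R, L]%classic.
  move=> t; rewrite /D /= !in_itv/= => /andP[t0 ts].
  by rewrite (ltW t0)/= (le_trans ts).
have iS2D : mu.-integrable D (EFin \o (fun t => S t ^+ 2)).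
  exact: (@integrableS _ _ _ mu _ D _ (measurable_itv _) mD DL iS2).
have ib : mu.-integrable D (EFin \o (fun t => L / 2 * g t ^+ 2 + (2 * L)^-1 * S t ^+ 2)).
  have := integrableD mD (@integrableZl _ _ _ mu D mD (L / 2) _ ig2) (@integrableZl _ _ _ mu D mD (2 * L)^-1 _ iS2D).
  by apply: eq_integrable => // t _; rewrite /= !EFinM EFinD.
have gS t : `|g t * S t| <= L / 2 * g t ^+ 2 + (2 * L)^-1 * S t ^+ 2.
  rewrite (_ : _ + _ = (2 * L)^-1 * ((L * g t) ^+ 2 + S t ^+ 2)); last by field; exact: lt0r_neq0.
  have L2 : 0 < 2 * L by lra.
  rewrite ler_norml; apply/andP; split; [rewrite lerNl|]; rewrite (ler_pdivlMl _ _ L2).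
    by rewrite -subr_ge0 (_ : _ - _ = (L * g t + S t) ^+ 2) ?sqr_ge0//; ring.
  by rewrite -subr_ge0 (_ : _ - _ = (L * g t - S t) ^+ 2) ?sqr_ge0//; ring.
have bound : (\int[mu]_(t in D) (g t * S t)%:E <=
     \int[mu]_(t in D) (L / 2 * g t ^+ 2 + (2 * L)^-1 * S t ^+ 2)%:E)%E.
  apply: (le_integral mD _ ib).
    apply: (le_integrableR mD _ _ ib) => //.
    by apply: measurable_funM => //; exact: measurable_funTS.
  by move=> t _; rewrite lee_fin (le_trans _ (gS t))// ler_norm.
have bound2 : (\int[mu]_(t in D) (L / 2 * g t ^+ 2 + (2 * L)^-1 * S t ^+ 2)%:E <=
   (L / 2)%:E * \int[mu]_(t in D) (g t ^+ 2)%:E + (2^-1 * \sum_(k <- A) c k ^+ 2)%:E)%E.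
  rewrite [leLHS](_ : _ = \int[mu]_(t in D) ((L / 2)%:E * (g t ^+ 2)%:E +
      ((2 * L)^-1)%:E * (S t ^+ 2)%:E))%E; last by apply: eq_integral.
  rewrite integralD//; [|exact: (@integrableZl _ _ _ mu D mD (L / 2) _ ig2)|
    exact: (@integrableZl _ _ _ mu D mD (2 * L)^-1 _ iS2D)].
  rewrite (integralZl mD ig2) (integralZl mD iS2D) leeD2l//.
  have H : (\int[mu]_(t in D) (S t ^+ 2)%:E <= (L * \sum_(k <- A) c k ^+ 2)%:E)%E.
    rewrite -[leRHS]S2int; apply: ge0_subset_integral => //.
    - by apply/measurable_EFinP; exact: (measurable_funTS (measurable_funX 2 mSf)).
    - by move=> t _; rewrite lee_fin sqr_ge0.
  apply: (@le_trans _ _ (((2 * L)^-1)%:E * (L * \sum_(k <- A) c k ^+ 2)%:E)%E).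
    by apply: lee_wpmul2l => //; rewrite lee_fin invr_ge0 mulr_ge0// ltW.
  rewrite -EFinM lee_fin le_eqVlt; apply/orP; left; apply/eqP.
  by field; exact: lt0r_neq0.
have := le_trans bound bound2.
rewrite -SE sumEFin.
have : (\int[mu]_(t in D) (g t ^+ 2)%:E)%E \is a fin_num.
  by rewrite ge0_fin_numE// integral_ge0// => t _; rewrite lee_fin sqr_ge0.
rewrite -/D; move: (\int[mu]_(t in D) _)%E => [I|//|//] _.
by rewrite -!EFinM -EFinD !lee_fin; lra.
Qed.

End bessel.

(** * Weighted averages of Hartley coefficients *)

Section weighted_average.
Context {R : realType}.
Notation mu := (@lebesgue_measure R).
Notation D := (`]0%R, +oo[%classic : set (measurableTypeR R)).
Implicit Types (a s t : R) (j k : int) (g : R -> R).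

(** No integrability is needed: the real-valued integral has the default value
    0 at the points where the extended integral is infinite. *)
Lemma measurable_Rintegral_param d (T : measurableType d) (F : T * measurableTypeR R -> R) :
  measurable_fun setT F ->
  measurable_fun setT (fun x => \int[mu]_t F (x, t)).
Proof.
move=> mF; apply: (measurableT_comp (fine_measurable _)); first exact: measurableT.
pose f z := (F z)%:E.
have mf : measurable_fun setT f by exact/measurable_EFinP.
rewrite (_ : (fun x => _) = fun x => (\int[mu]_t (f^\+ (x, t)) - \int[mu]_t (f^\- (x, t)))%E).
  by apply: emeasurable_funB; apply: measurable_fun_fubini_tonelli_F => //;
    [exact: measurable_funepos|exact: measurable_funeneg].
by apply/funext => x; rewrite integralE; congr (_ - _)%E;
  apply: eq_integral => t _; rewrite ?funeposE ?funenegE.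
Qed.

Lemma measurable_hartley_coef a k g : measurable_fun setT g ->
  measurable_fun setT (hartley_coef a k g).
Proof.
move=> mg.
pose F (z : measurableTypeR R * measurableTypeR R) :=
  if (0 < z.2) && (z.2 <= z.1) then hartley a k z.2 * g z.2 else 0.
rewrite (_ : hartley_coef a k g = fun s => \int[mu]_t F (s, t)).
  apply: measurable_Rintegral_param; apply: measurable_fun_ifT => //.
  - apply: measurable_and.
      by apply: measurable_fun_ltr => //; exact: measurable_snd.
    by apply: measurable_fun_ler; [exact: measurable_snd|exact: measurable_fst].
  - have m2 : measurable_fun setT (fun z : measurableTypeR R * measurableTypeR R => z.2).
      exact: measurable_snd.
    have mh : @measurable_fun _ _ (measurableTypeR R) (measurableTypeR R) setT (hartley a k).
      exact: measurable_hartley.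
    have mg' : @measurable_fun _ _ (measurableTypeR R) (measurableTypeR R) setT g by exact: mg.
    by apply: measurable_funM; [exact: (measurableT_comp mh m2)|exact: (measurableT_comp mg' m2)].
apply/funext => s; rewrite /hartley_coef Rintegral_mkcond; congr Rintegral.
by apply/funext => t; rewrite patchE mem_setE in_itv.
Qed.

Lemma measurable_expRN (c : R) (E : set R) : measurable_fun E (fun s => expR (- (c * s))).
Proof.
by apply: measurable_funTS; apply: continuous_measurable_fun; exact: continuous_expRN.
Qed.

(** The common bound of the derivatives of the slowly varying factors at scale
    a; the factor 10 comes from 3/2 + 2 pi <= 10. *)
Definition laplace_weight a s : R := 10 * a * expR (- (a / 2 * s)).

Lemma laplace_weight_ge0 a s : 0 < a -> 0 <= laplace_weight a s.
Proof. by move=> a0; rewrite !mulr_ge0 ?expR_ge0// ltW. Qed.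

Lemma measurable_laplace_weight a (E : set R) : measurable_fun E (laplace_weight a).
Proof.
by apply: measurable_funM => //; exact: measurable_expRN.
Qed.

Lemma integral_expRN0 c : 0 < c ->
  (\int[mu]_(s in D) (expR (- (c * s)))%:E = (c^-1)%:E)%E.
Proof.
move=> c0; rewrite integral_itv_obnd_cbnd; last first.
  apply/measurable_EFinP; exact: measurable_expRN.
by rewrite integral_expRN// mulr0 oppr0 expR0 mulr1.
Qed.

Lemma integral_laplace_weight a : 0 < a ->
  (\int[mu]_(s in D) (laplace_weight a s)%:E = 20%:E)%E.
Proof.
move=> a0; rewrite ge0_integralZlR.
- rewrite integral_expRN0 ?divr_gt0// -EFinM; congr EFin; field; exact: lt0r_neq0.
- exact: measurable_itv.
- exact: measurable_expRN.
- by move=> x _; rewrite expR_ge0.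
- by rewrite mulr_ge0// ltW.
Qed.

(** The Cauchy-Schwarz inequality for the measure of density w and total mass W,
    obtained from 2 h <= c + h^2 / c by optimizing c. *)
Lemma sqr_integral_le (E : set (measurableTypeR R)) (w h : R -> R) (W J : R) :
  measurable E -> measurable_fun E w -> measurable_fun E h ->
  (forall x, E x -> 0 <= w x) -> (forall x, E x -> 0 <= h x) -> 0 < W ->
  (\int[mu]_(x in E) (w x)%:E = W%:E)%E ->
  (\int[mu]_(x in E) (w x * h x ^+ 2)%:E <= J%:E)%E ->
  (\int[mu]_(x in E) (w x * h x)%:E < +oo)%E /\
  fine (\int[mu]_(x in E) (w x * h x)%:E) ^+ 2 <= W * J.
Proof.
move=> mE mw mh w0 h0 W0 wW wJ.
have mwh2 : measurable_fun E (fun x => w x * h x ^+ 2).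
  by apply: measurable_funM => //; exact: measurable_funX.
have H c : 0 < c -> (\int[mu]_(x in E) (w x * h x)%:E <= (c / 2 * W + (2 * c)^-1 * J)%:E)%E.
  move=> c0.
  apply: (@le_trans _ _ (\int[mu]_(x in E) (c / 2 * w x + (2 * c)^-1 * (w x * h x ^+ 2))%:E)%E).
    apply: ge0_le_integralR => //.
    - exact: measurable_funM.
    - by apply: measurable_funD; exact: measurable_funM.
    - by move=> x Ex; rewrite mulr_ge0 ?w0 ?h0.
    - move=> x Ex; rewrite -subr_ge0.
      rewrite (_ : _ - _ = w x * ((2 * c)^-1 * (c - h x) ^+ 2)); last by field; exact: lt0r_neq0.
      by rewrite mulr_ge0 ?w0// mulr_ge0 ?sqr_ge0// invr_ge0 mulr_ge0// ltW.
  under eq_integral do rewrite EFinD.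
  rewrite ge0_integralD//; last 4 first.
  - by move=> x Ex; rewrite lee_fin mulr_ge0 ?w0// divr_ge0// ltW.
  - by apply/measurable_EFinP; exact: measurable_funM.
  - move=> x Ex; rewrite lee_fin (mulr_ge0 _ (mulr_ge0 (w0 _ Ex) (sqr_ge0 _)))//.
    by rewrite invr_ge0 mulr_ge0// ltW.
  - by apply/measurable_EFinP; exact: measurable_funM.
  have c20 : 0 <= (2 * c)^-1 by rewrite invr_ge0 mulr_ge0// ltW.
  rewrite !ge0_integralZlR//; last 2 first.
  - by move=> x Ex; rewrite (mulr_ge0 (w0 _ Ex) (sqr_ge0 _)).
  - by rewrite divr_ge0// ltW.
  by rewrite wW EFinD !EFinM leeD2l// lee_wpmul2l// lee_fin.
have J0 : 0 <= J.
  rewrite -lee_fin (le_trans _ wJ)//; apply: integral_ge0 => x Ex.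
  by rewrite lee_fin (mulr_ge0 (w0 _ Ex) (sqr_ge0 _)).
split; first exact: (le_lt_trans (H 1 ltr01) (ltry _)).
have : (0 <= \int[mu]_(x in E) (w x * h x)%:E)%E.
  by apply: integral_ge0 => x Ex; rewrite lee_fin mulr_ge0 ?w0 ?h0.
move: (\int[mu]_(x in E) (w x * h x)%:E)%E H => [r|//|//] H.
  rewrite lee_fin le_eqVlt => /orP[/eqP <-|r0]/=.
    by rewrite expr0n/= mulr_ge0// ltW.
  have := H (r / W) (divr_gt0 r0 W0); rewrite lee_fin.
  have -> : r / W / 2 * W + (2 * (r / W))^-1 * J = r / 2 + W * J / (2 * r).
    by field; rewrite !lt0r_neq0.
  rewrite -lerBlDl ler_pdivlMr ?mulr_gt0// => H1; apply: le_trans H1.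
  by rewrite le_eqVlt; apply/orP; left; apply/eqP; field.
by have := H 1 ltr01.
Qed.

(** The average called H_k g above; as an operator on g it is sublinear. *)
Definition hartley_average a k g : \bar R :=
  (\int[mu]_(s in D) (laplace_weight a s * `|hartley_coef a k g s|)%:E)%E.

Lemma hartley_average_ge0 a k g : 0 < a -> (0 <= hartley_average a k g)%E.
Proof.
move=> a0; apply: integral_ge0 => s _.
by rewrite lee_fin mulr_ge0// laplace_weight_ge0.
Qed.

Lemma hartley_average_fin_num a k g : 0 < a -> (hartley_average a k g < +oo)%E ->
  hartley_average a k g \is a fin_num.
Proof. by move=> a0 h; rewrite ge0_fin_numE// hartley_average_ge0. Qed.

Lemma measurable_abs_hartley_coef a k g (E : set R) : measurable_fun setT g ->
  measurable_fun E (fun s => `|hartley_coef a k g s|).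
Proof.
move=> mg; apply: measurable_funTS.
by apply: (measurableT_comp (@normr_measurable _ _)); exact: measurable_hartley_coef.
Qed.

(** The L^2 to l^2 bound: Cauchy-Schwarz in s, then Bessel's inequality for each
    s on N = floor (a s) + 1 periods. *)
Lemma sum_sqr_hartley_average a (A : seq int) g (I : R) : 0 < a -> uniq A ->
  measurable_fun setT g -> (\int[mu]_(t in D) (g t ^+ 2)%:E <= I%:E)%E ->
  (forall k, k \in A -> (hartley_average a k g < +oo)%E) /\
  \sum_(k <- A) fine (hartley_average a k g) ^+ 2 <= 20 * 160 / a * I.
Proof.
move=> a0 uA mg gI.
have mD : measurable D by exact: measurable_itv.
pose J k := (\int[mu]_(s in D) (laplace_weight a s * `|hartley_coef a k g s| ^+ 2)%:E)%E.
have J0 k : (0 <= J k)%E.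
  apply: integral_ge0 => s _.
  by rewrite lee_fin (mulr_ge0 (laplace_weight_ge0 _ a0) (sqr_ge0 _)).
have I0 : 0 <= I.
  by rewrite -lee_fin (le_trans _ gI)// integral_ge0// => t _; rewrite lee_fin sqr_ge0.
have mJ k : measurable_fun D (fun s => laplace_weight a s * `|hartley_coef a k g s| ^+ 2).
  apply: measurable_funM; first exact: measurable_laplace_weight.
  by apply: measurable_funX; exact: measurable_abs_hartley_coef.
have sumJ : (\sum_(k <- A) J k <= (160 / a * I)%:E)%E.
  rewrite -(ge0_integral_sum mu mD (f := fun k s =>
    (laplace_weight a s * `|hartley_coef a k g s| ^+ 2)%:E)); last 2 first.
  - by move=> k; apply/measurable_EFinP; exact: mJ.
  - by move=> k s _; rewrite lee_fin (mulr_ge0 (laplace_weight_ge0 _ a0) (sqr_ge0 _)).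
  under eq_integral do rewrite sumEFin.
  have c0 : 0 <= 40 * I by rewrite mulr_ge0.
  apply: (@le_trans _ _ (\int[mu]_(s in D) (40 * I * expR (- (a / 4 * s)))%:E)%E).
    apply: ge0_le_integralR => //.
    - by apply: measurable_sum => k; exact: mJ.
    - apply: measurable_funM => //; exact: measurable_expRN.
    - move=> s _; apply: sumr_ge0 => k _.
      by rewrite (mulr_ge0 (laplace_weight_ge0 _ a0) (sqr_ge0 _)).
    move=> s; rewrite /= in_itv/= andbT => s0.
    pose N := (Num.truncn (a * s)).+1.
    have as0 : 0 <= a * s by rewrite mulr_ge0// ltW.
    have sN : s <= N%:R / a.
      by rewrite ler_pdivlMr// mulrC ltW// truncnS_gt.
    have Ns : N%:R / a <= s + a^-1.
      rewrite ler_pdivrMr// mulrDl mulVf ?lt0r_neq0// mulrC /N -natr1 lerD2r.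
      by rewrite truncn_le.
    have B : \sum_(k <- A) hartley_coef a k g s ^+ 2 <= N%:R / a * I.
      rewrite -lee_fin -sumEFin.
      apply: (le_trans (bessel_hartley a0 (ltn0Sn _) sN uA mg)).
      rewrite [leRHS]EFinM lee_wpmul2l ?lee_fin ?divr_ge0// ?(ltW a0)//.
      apply: le_trans gI; apply: ge0_subset_integral => //.
      + exact/measurable_EFinP/measurable_funX/measurable_funTS.
      + by move=> t _; rewrite lee_fin sqr_ge0.
      + by move=> t; rewrite /= !in_itv/= andbT => /andP[].
    rewrite -mulr_sumr.
    under eq_bigr do rewrite real_normK ?num_real//.
    apply: (le_trans (ler_wpM2l (laplace_weight_ge0 s a0) B)).
    apply: (le_trans (ler_wpM2l (laplace_weight_ge0 s a0) (ler_wpM2r I0 Ns))).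
    rewrite /laplace_weight (_ : - (a / 2 * s) = - (a / 4 * s) + - (a / 4 * s)); last by field.
    rewrite expRD; have := expR_ge1Dx (a / 4 * s).
    have := expRxMexpNx_1 (a / 4 * s).
    move: (expR_gt0 (- (a / 4 * s))) (expR_gt0 (a / 4 * s)).
    move: (expR (a / 4 * s)) (expR (- (a / 4 * s))) => u v v0 u0 uv us.
    have -> : 10 * a * (v * v) * ((s + a^-1) * I) = 10 * v * I * (v * (a * s + 1)).
      by field; exact: lt0r_neq0.
    rewrite (_ : 40 * I * v = 10 * v * I * 4); last by ring.
    apply: ler_wpM2l; first by rewrite !mulr_ge0// ltW.
    by nra.
  rewrite ge0_integralZlR//; last exact: measurable_expRN.
  rewrite integral_expRN0 ?divr_gt0// -EFinM lee_fin le_eqVlt.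
  by apply/orP; left; apply/eqP; field; exact: lt0r_neq0.
have Jfin k : k \in A -> J k = (fine (J k))%:E.
  move=> kA; rewrite fineK// ge0_fin_numE//.
  apply: (le_lt_trans _ (ltry (160 / a * I))); apply: le_trans sumJ.
  by rewrite (big_rem _ kA)/= leeDl// sume_ge0.
have CS k : k \in A -> (hartley_average a k g < +oo)%E /\
    fine (hartley_average a k g) ^+ 2 <= 20 * fine (J k).
  move=> kA; apply: sqr_integral_le => //.
  - exact: measurable_laplace_weight.
  - exact: measurable_abs_hartley_coef.
  - by move=> s _; exact: laplace_weight_ge0.
  - exact: integral_laplace_weight.
  - by rewrite -Jfin.
split=> [k /CS[]//|].
apply: (@le_trans _ _ (\sum_(k <- A) 20 * fine (J k))).
  by rewrite big_seq [leRHS]big_seq; apply: ler_sum => k /CS[].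
rewrite -mulr_sumr (_ : 20 * 160 / a * I = 20 * (160 / a * I)); last by field; exact: lt0r_neq0.
rewrite ler_pM2l// -lee_fin -sumEFin (le_trans _ sumJ)//.
rewrite big_seq [leRHS]big_seq le_eqVlt; apply/orP; left; apply/eqP.
by apply: eq_bigr => k kA; rewrite -Jfin.
Qed.

End weighted_average.

(** * The discrete Hausdorff-Young inequality *)

Section interpolation.
Context {R : realType}.
Notation mu := (@lebesgue_measure R).
Notation D := (`]0%R, +oo[%classic : set (measurableTypeR R)).
Implicit Types (a s t : R) (j k : int) (g : R -> R).

Let subD s : `]0%R, s]%classic `<=` D.
Proof. by move=> t; rewrite /= !in_itv/= andbT => /andP[]. Qed.

(** The L^1 to l^oo bound. *)
Lemma hartley_average_le a k g : 0 < a -> measurable_fun setT g ->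
  (hartley_average a k g <= 40%:E * \int[mu]_(t in D) `|g t|%:E)%E.
Proof.
move=> a0 mg; have mD : measurable D by exact: measurable_itv.
have I0 : (0 <= \int[mu]_(t in D) `|g t|%:E)%E.
  by apply: integral_ge0 => t _; rewrite lee_fin.
have mag : measurable_fun D (fun t => `|g t|).
  by apply: measurableT_comp => //; exact: measurable_funTS.
case IE : (\int[mu]_(t in D) `|g t|%:E)%E I0 => [I| |//] I0; last first.
  by rewrite gt0_muley ?lte_fin// leey.
have ig s : mu.-integrable (`]0%R, s]%classic : set (measurableTypeR R)) (EFin \o g).
  apply: (@integrableS _ _ _ mu D _ _ mD (measurable_itv _) (@subD s)).
  apply: (le_integrableR mD (g := fun t => `|g t|)) => //; first exact: measurable_funTS.
  by apply: ge0_integrableR => //; rewrite IE ltry.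
have coefI s : `|hartley_coef a k g s| <= 2 * I.
  have ihg := integrable_hartleyM a k (measurable_itv _) (ig s).
  rewrite /hartley_coef; apply: (le_trans (@le_normr_Rintegral _ _ _ mu _ _ (measurable_itv _) ihg)).
  rewrite -lee_fin /Rintegral fineK; last first.
    by apply: integrable_fin_num => //; exact: (integrable_norm ihg).
  rewrite EFinM -IE -ge0_integralZlR//.
  apply: (@le_trans _ _ (\int[mu]_(t in `]0%R, s]) (2 * `|g t|)%:E)%E).
    apply: ge0_le_integralR => //.
    - apply: measurableT_comp => //; apply: measurable_funM; first exact: measurable_hartley.
      exact: measurable_funTS.
    - apply: measurable_funM => //; apply: measurableT_comp => //; exact: measurable_funTS.
    - by move=> t _; rewrite normrM ler_wpM2r// hartley_le2.
  apply: ge0_subset_integral => //.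
  - by apply/measurable_EFinP; exact: measurable_funM.
apply: (@le_trans _ _ (\int[mu]_(s in D) (2 * I * laplace_weight a s)%:E)%E).
  apply: ge0_le_integralR => //.
  - apply: measurable_funM; first exact: measurable_laplace_weight.
    exact: measurable_abs_hartley_coef.
  - by apply: measurable_funM => //; exact: measurable_laplace_weight.
  - by move=> s _; rewrite mulr_ge0// laplace_weight_ge0.
  - by move=> s _; rewrite mulrC ler_wpM2r// laplace_weight_ge0.
rewrite ge0_integralZlR//; last 3 first.
- exact: measurable_laplace_weight.
- by move=> s _; exact: laplace_weight_ge0.
- by rewrite mulr_ge0// -lee_fin.
rewrite integral_laplace_weight// -!EFinM lee_fin le_eqVlt; apply/orP; left; apply/eqP; ring.
Qed.

Lemma hartley_averageD a k g g1 g2 : 0 < a ->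
  measurable_fun setT g -> measurable_fun setT g1 -> measurable_fun setT g2 ->
  (forall t, g t = g1 t + g2 t) ->
  (forall s, mu.-integrable (`]0%R, s]%classic : set (measurableTypeR R)) (EFin \o g1)) ->
  (forall s, mu.-integrable (`]0%R, s]%classic : set (measurableTypeR R)) (EFin \o g2)) ->
  (hartley_average a k g <= hartley_average a k g1 + hartley_average a k g2)%E.
Proof.
move=> a0 mg m1 m2 gE i1 i2; have mD : measurable D by exact: measurable_itv.
have mw h : measurable_fun setT h ->
    measurable_fun D (fun s => laplace_weight a s * `|hartley_coef a k h s|).
  move=> mh; apply: measurable_funM; first exact: measurable_laplace_weight.
  exact: measurable_abs_hartley_coef.
have w0 h s : 0 <= laplace_weight a s * `|hartley_coef a k h s|.
  by rewrite mulr_ge0// laplace_weight_ge0.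
have cE s : hartley_coef a k g s = hartley_coef a k g1 s + hartley_coef a k g2 s.
  rewrite /hartley_coef -RintegralD//; last 2 first.
  - by apply: integrable_hartleyM => //; exact: i1.
  - by apply: integrable_hartleyM => //; exact: i2.
  by apply: eq_Rintegral => t _; rewrite gE mulrDr.
rewrite /hartley_average -ge0_integralD//; last 4 first.
- by move=> s _; rewrite lee_fin.
- by apply/measurable_EFinP; exact: mw.
- by move=> s _; rewrite lee_fin.
- by apply/measurable_EFinP; exact: mw.
apply: (@le_trans _ _ (\int[mu]_(s in D) (laplace_weight a s * `|hartley_coef a k g1 s|
   + laplace_weight a s * `|hartley_coef a k g2 s|)%:E)%E); last by [].
apply: ge0_le_integralR => //.
- exact: mw.
- by apply: measurable_funD; exact: mw.
- by move=> s _; rewrite -mulrDr cE ler_wpM2l ?laplace_weight_ge0// ler_normD.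
Qed.

(** The case q = 2 is the L^2 bound itself; interpolation covers q > 2. *)
Definition hartley_const (q : R) : R :=
  if q == 2 then 20 * 160 else marcinkiewicz_const q * 40 `^ (q - 2) * (20 * 160).

Lemma marcinkiewicz_const_gt0 (q : R) : 2 < q -> 0 < marcinkiewicz_const q.
Proof.
move=> q2; rewrite !mulr_gt0 ?powR_gt0// invr_gt0 subr_gt0 powRN invf_lt1 ?powR_gt0//.
have q20 : 0 < q - 2 by lra.
have := @gt0_ltr_powR R (q - 2) q20 1 2; rewrite !nnegrE powR1; apply; lra.
Qed.

Lemma hartley_const_gt0 (q : R) : 2 <= q -> 0 < hartley_const q.
Proof.
have h : (0:R) < 20 * 160 by apply: mulr_gt0; rewrite ltr0n.
rewrite /hartley_const => q2; case: ifPn => // qn2.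
apply: mulr_gt0 h; apply: mulr_gt0; last exact: powR_gt0.
by apply: marcinkiewicz_const_gt0; rewrite lt_neqAle eq_sym qn2.
Qed.

(** The interpolated bound, for a positive bound P on the p-th moment of g. *)
Lemma sum_powR_hartley_average_gt0 (q a P : R) (A : seq int) g : 2 <= q -> 0 < a -> 0 < P ->
  uniq A -> measurable_fun setT g ->
  (\int[mu]_(t in D) (`|g t| `^ (q / (q - 1)))%:E <= P%:E)%E ->
  (forall k, k \in A -> (hartley_average a k g < +oo)%E) /\
  \sum_(k <- A) fine (hartley_average a k g) `^ q <= hartley_const q / a * P `^ (q - 1).
Proof.
move=> q2 a0 P0 uA mg gP; have mD : measurable D by exact: measurable_itv.
move: q2; rewrite le_eqVlt => /predU1P[q2|q2].
  have gP2 : (\int[mu]_(t in D) (g t ^+ 2)%:E <= P%:E)%E.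
    apply: le_trans gP; rewrite le_eqVlt; apply/orP; left; apply/eqP.
    apply: eq_integral => t _; congr EFin.
    rewrite (_ : q / (q - 1) = 2%:R) -?q2; first by rewrite powR_mulrn// real_normK ?num_real.
    by field; lra.
  have [H1 H2] := sum_sqr_hartley_average a0 uA mg gP2; split=> //.
  rewrite /hartley_const -q2 eqxx (_ : 2 - 1 = 1); last by ring.
  rewrite powRr1 ?(ltW P0)//; apply: le_trans H2; rewrite le_eqVlt; apply/orP; left; apply/eqP.
  by apply: eq_bigr => k _; rewrite powR_mulrn// fine_ge0// hartley_average_ge0.
set p := q / (q - 1) in gP.
have q10 : 0 < q - 1 by lra.
have p1 : 1 < p by rewrite /p ltr_pdivlMr//; lra.
have p2 : p <= 2 by rewrite /p ler_pdivrMr//; lra.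
(* The parts of g above and below the level s. *)
pose hi s t := if s < `|g t| then g t else 0.
pose lo s t := if `|g t| <= s then g t else 0.
have mng : measurable_fun setT (fun t => `|g t|) by exact: measurableT_comp.
have mhi s : measurable_fun setT (hi s).
  by apply: measurable_fun_ifT => //; exact: measurable_fun_ltr.
have mlo s : measurable_fun setT (lo s).
  by apply: measurable_fun_ifT => //; exact: measurable_fun_ler.
have ghl s t : g t = hi s t + lo s t.
  by rewrite /hi /lo; case: ltP; rewrite ?addr0 ?add0r.
have mgp : measurable_fun setT (fun t => `|g t| `^ p).
  exact: (measurableT_comp (measurable_powR _)).
have hiE s t : `|hi s t| = if s < `|g t| then `|g t| else 0.
  by rewrite /hi; case: ifP; rewrite ?normr0.
have loE s t : lo s t ^+ 2 = if `|g t| <= s then g t ^+ 2 else 0.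
  by rewrite /lo; case: ifP; rewrite ?expr0n.
have ilo s u : mu.-integrable (`]0%R, u]%classic : set (measurableTypeR R)) (EFin \o lo s).
  have mu0 : measurable (`]0%R, u]%classic : set (measurableTypeR R)) by exact: measurable_itv.
  apply: (@le_integrableR _ _ _ mu _ mu0 _ (cst `|s|)).
  - exact: (measurable_funTS (mlo s)).
  - move=> t _; rewrite /lo/=; case: ifPn => [gs|_]; last by rewrite normr0.
    exact: (le_trans gs (ler_norm _)).
  - apply: integrable_cstR => //; exact: lty_measure_oc.
have hi_p s t : 0 < s -> `|hi s t| <= s `^ (1 - p) * `|g t| `^ p.
  move=> s0; rewrite hiE; case: ifPn => [sg|_]; last by rewrite mulr_ge0 ?powR_ge0.
  rewrite -opprB powRN ler_pdivlMl ?powR_gt0// mulrC -[leRHS]mulr_powRB1//; last by lra.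
  apply: ler_wpM2l => //; apply: ge0_ler_powR; rewrite ?nnegrE ?(ltW s0) ?(ltW sg)//; lra.
have lo_p s t : 0 < s -> lo s t ^+ 2 <= s `^ (2 - p) * `|g t| `^ p.
  move=> s0; rewrite loE; case: ifPn => [gs|_]; last by rewrite mulr_ge0 ?powR_ge0.
  have [->|g0] := eqVneq (g t) 0; first by rewrite expr0n/= mulr_ge0 ?powR_ge0.
  have -> : g t ^+ 2 = `|g t| `^ (2 - p) * `|g t| `^ p.
    rewrite -powRD; last by rewrite normr_eq0 g0 implybT.
    by rewrite subrK powR_mulrn// real_normK ?num_real.
  apply: ler_wpM2r; first exact: powR_ge0.
  by apply: ge0_ler_powR; rewrite ?nnegrE ?(ltW s0)//; lra.
have int_p (c : R) (f : R -> R) : measurable_fun setT f -> (forall t, 0 <= f t) ->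
    0 <= c -> (forall t, f t <= c * `|g t| `^ p) -> (\int[mu]_(t in D) (f t)%:E < +oo)%E.
  move=> mf f0 c0 fc; apply: (le_lt_trans _ (ltry (c * P))).
  apply: (@le_trans _ _ (\int[mu]_(t in D) (c * `|g t| `^ p)%:E)%E).
    apply: ge0_le_integralR => //; first exact: (measurable_funTS mf).
    exact: (measurable_funTS (measurable_funM (measurable_cst _) mgp)).
  rewrite ge0_integralZlR//; last exact: (measurable_funTS mgp).
  by rewrite [leRHS]EFinM; apply: lee_wpmul2l; rewrite ?lee_fin.
have hi_fin s : 0 < s -> (\int[mu]_(t in D) `|hi s t|%:E < +oo)%E.
  move=> s0; apply: (int_p (s `^ (1 - p))) => //.
  - exact: measurableT_comp.
  - exact: powR_ge0.
  - by move=> t; exact: hi_p.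
have lo_fin s : 0 < s -> (\int[mu]_(t in D) (lo s t ^+ 2)%:E < +oo)%E.
  move=> s0; apply: (int_p (s `^ (2 - p))) => //.
  - exact: measurable_funX.
  - by move=> t; rewrite sqr_ge0.
  - exact: powR_ge0.
  - by move=> t; exact: lo_p.
have loI s : 0 < s -> (\int[mu]_(t in D) (lo s t ^+ 2)%:E <=
    (fine (\int[mu]_(t in D) (lo s t ^+ 2)%:E)%E)%:E)%E.
  move=> s0; rewrite fineK// ge0_fin_numE; first exact: lo_fin.
  by apply: integral_ge0 => t _; rewrite lee_fin sqr_ge0.
have ihi s u : 0 < s ->
    mu.-integrable (`]0%R, u]%classic : set (measurableTypeR R)) (EFin \o hi s).
  move=> s0; apply: (@integrableS _ _ _ mu D _ _ mD (measurable_itv _) (@subD u)).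
  apply: (le_integrableR mD (g := fun t => `|hi s t|)) => //.
    exact: (measurable_funTS (mhi s)).
  apply: ge0_integrableR => //; last exact: hi_fin.
  exact: (measurable_funTS (measurableT_comp (@normr_measurable R setT) (mhi s))).
have Hhl k s : 0 < s ->
    (hartley_average a k g <= hartley_average a k (hi s) + hartley_average a k (lo s))%E.
  move=> s0; exact: (hartley_averageD k a0 mg (mhi s) (mlo s) (ghl s)
    (fun u => ihi s u s0) (ilo s)).
have lofin k s : 0 < s -> (hartley_average a k (lo s) < +oo)%E.
  move=> s0; have [H _] := @sum_sqr_hartley_average R a [:: k] (lo s) _ a0 isT (mlo s) (loI _ s0).
  by apply: H; rewrite inE.
have hifin k s : 0 < s -> (hartley_average a k (hi s) < +oo)%E.
  move=> s0; apply: (le_lt_trans (hartley_average_le k a0 (mhi s))).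
  by rewrite lte_mul_pinfty ?hi_fin.
have gfin k : (hartley_average a k g < +oo)%E.
  exact: (le_lt_trans (Hhl k 1 ltr01) (lte_add_pinfty (hifin k 1 ltr01) (lofin k 1 ltr01))).
have fK h k : (hartley_average a k h < +oo)%E ->
    (fine (hartley_average a k h))%:E = hartley_average a k h.
  by move=> hfin; rewrite fineK// ge0_fin_numE// hartley_average_ge0.
split=> [k _|]; first exact: gfin.
have c40 : (0:R) < 40 by rewrite ltr0n.
have c0 : 0 < 20 * 160 / a :> R by rewrite divr_gt0// mulr_gt0// ltr0n.
apply: (le_trans (@marcinkiewicz R q 40 (20 * 160 / a) P D g _ A
  (fun k => fine (hartley_average a k g))
  (fun k s => fine (hartley_average a k (lo s))) q2 c40 c0 P0 mD _ gP _ _ _)).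
- exact: (measurable_funTS mg).
- by move=> k _; rewrite fine_ge0// hartley_average_ge0.
- move=> k s _ s0; rewrite (fK _ _ (gfin k)) (fK _ _ (lofin k s s0)).
  apply: (le_trans (Hhl k s s0)); rewrite leeD2r//.
  apply: (le_trans (hartley_average_le k a0 (mhi s))).
  rewrite le_eqVlt; apply/orP; left; apply/eqP; congr (_ * _)%E.
  by apply: eq_integral => t _; rewrite hiE.
- move=> s s0; have [_ H] := sum_sqr_hartley_average a0 uA (mlo s) (loI s s0).
  rewrite sumEFin; apply: (@le_trans _ _ (20 * 160 / a *
      fine (\int[mu]_(t in D) (lo s t ^+ 2)%:E)%E)%:E); first by rewrite lee_fin.
  rewrite EFinM fineK; last first.
    rewrite ge0_fin_numE; first exact: lo_fin.
    by apply: integral_ge0 => t _; rewrite lee_fin sqr_ge0.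
  rewrite le_eqVlt; apply/orP; left; apply/eqP; congr (_ * _)%E.
  by apply: eq_integral => t _; rewrite loE.
rewrite /hartley_const gt_eqF// le_eqVlt; apply/orP; left; apply/eqP.
by field; exact: lt0r_neq0.
Qed.

End interpolation.

(** * Separating the slowly varying factor *)

Section separation.
Context {R : realType}.
Notation mu := (@lebesgue_measure R).
Notation mR := (measurableTypeR R).
Notation D := (`]0%R, +oo[%classic : set (measurableTypeR R)).
Implicit Types (a s t : R) (j k : int) (g : R -> R).

(** An exponentially damped oscillation; this class of functions is closed under
    differentiation. *)
Definition damped (b eta al ga t : R) : R :=
  expR (- (b * t)) * (al * cos (eta * t) + ga * sin (eta * t)).

Lemma is_derive_damped (b eta al ga x : R) :
  is_derive x (1:R) (damped b eta al ga)
    (- damped b eta (b * al - ga * eta) (b * ga + al * eta) x).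
Proof.
have H1 := is_derive_expRN b x.
have H2 := is_derive_cosM eta x; have H3 := is_derive_sinM eta x.
by apply: is_derive_eq; rewrite /damped /GRing.scale/=; ring.
Qed.

Lemma continuous_damped (b eta al ga : R) : continuous (damped b eta al ga).
Proof. exact: (continuous_of_is_derive (is_derive_damped b eta al ga)). Qed.

Lemma damped_le (b eta al ga t : R) :
  `|damped b eta al ga t| <= (`|al| + `|ga|) * expR (- (b * t)).
Proof.
rewrite normrM ger0_norm ?expR_ge0// mulrC ler_wpM2r ?expR_ge0//.
apply: (le_trans (ler_normD _ _)); rewrite !normrM lerD// ler_piMr//.
  exact: cos_max.
exact: sin_max.
Qed.

Lemma cvg_damped (b eta al ga : R) : 0 < b -> damped b eta al ga t @[t --> +oo] --> (0:R).
Proof.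
move=> b0; apply/cvgr0Pnorm_le => e e0.
have := cvg_expRN_y b0 => /cvgr0Pnorm_le.
have c0 : 0 < `|al| + `|ga| + 1 by rewrite ltr_wpDl// addr_ge0.
move=> /(_ (e / (`|al| + `|ga| + 1)) (divr_gt0 e0 c0)).
apply: filterS => t; rewrite ger0_norm ?expR_ge0// ler_pdivlMr// => H.
apply: (le_trans (damped_le _ _ _ _ _)); apply: le_trans H; rewrite mulrC.
by rewrite ler_wpM2l ?expR_ge0// lerDl.
Qed.

Lemma measurable_damped (b eta al ga : R) (E : set mR) :
  measurable_fun E (damped b eta al ga).
Proof.
by apply: measurable_funTS; apply: continuous_measurable_fun; exact: continuous_damped.
Qed.

Lemma integrable_expRN (b t : R) : 0 < b ->
  mu.-integrable (`[t, +oo[%classic : set mR) (EFin \o (fun s => expR (- (b * s)))).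
Proof.
move=> b0; apply: ge0_integrableR => //; first exact: measurable_expRN.
by rewrite integral_expRN// ltry.
Qed.

Lemma integrable_damped (b eta al ga t : R) : 0 < b ->
  mu.-integrable (`[t, +oo[%classic : set mR) (EFin \o damped b eta al ga).
Proof.
move=> b0; have mt : measurable (`[t, +oo[%classic : set mR) by exact: measurable_itv.
apply: (@le_integrableR _ _ _ mu _ mt _ (fun s => (`|al| + `|ga|) * expR (- (b * s)))).
- exact: measurable_damped.
- by move=> s _; exact: damped_le.
- have := @integrableZl _ _ _ mu _ mt (`|al| + `|ga|) _ (integrable_expRN t b0).
  by apply: eq_integrable => // s _; rewrite /= EFinM.
Qed.

(** A damped oscillation is the integral of the opposite of its derivative over
    the half-line that starts at t. Adding a multiple of an exponential reduces
    this to a nonnegative integrand. *)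
Lemma integral_damped (b eta al ga t : R) : 0 < b ->
  (\int[mu]_(s in `[t, +oo[) (damped b eta (b * al - ga * eta) (b * ga + al * eta) s)%:E
    = (damped b eta al ga t)%:E)%E.
Proof.
move=> b0; have mt : measurable (`[t, +oo[%classic : set mR) by exact: measurable_itv.
set al' := b * al - ga * eta; set ga' := b * ga + al * eta.
pose c := `|al'| + `|ga'|.
have c0 : 0 <= c by rewrite addr_ge0.
have dF x : is_derive x (1:R) (fun s => - damped b eta al ga s - c * b^-1 * expR (- (b * s)))
    (damped b eta al' ga' x + c * expR (- (b * x))).
  have H1 := is_derive_damped b eta al ga x; have H2 := is_derive_expRN b x.
  apply: is_derive_eq; rewrite -/al' -/ga' /GRing.scale/=.
  by field; exact: lt0r_neq0.
have cf : continuous (fun x => damped b eta al' ga' x + c * expR (- (b * x))).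
  move=> x; apply: continuousD; first exact: continuous_damped.
  by apply: continuousM; [exact: cst_continuous|exact: continuous_expRN].
have f0 x : t <= x -> 0 <= damped b eta al' ga' x + c * expR (- (b * x)).
  move=> _; have := damped_le b eta al' ga' x; rewrite -/c ler_norml => /andP[]; lra.
have l0 : (- damped b eta al ga s - c * b^-1 * expR (- (b * s))) @[s --> +oo] --> (0:R).
  rewrite (_ : 0 = - 0 - c * b^-1 * 0); last by ring.
  apply: cvgB; first by apply: cvgN; exact: cvg_damped.
  by apply: cvgM; [exact: cvg_cst|exact: cvg_expRN_y].
have := ge0_integral_is_derive_y dF cf f0 l0.
under eq_integral do rewrite EFinD.
have ie : mu.-integrable (`[t, +oo[%classic : set mR) (fun s => (c * expR (- (b * s)))%:E).
  have := @integrableZl _ _ _ mu _ mt c _ (integrable_expRN t b0).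
  by apply: eq_integrable => // s _; rewrite /= EFinM.
rewrite (integralD mt (integrable_damped eta al' ga' t b0) ie).
have -> : (\int[mu]_(s in `[t, +oo[) (c * expR (- (b * s)))%:E =
    (c * (b^-1 * expR (- (b * t))))%:E)%E.
  rewrite ge0_integralZlR//; last exact: measurable_expRN.
  by rewrite integral_expRN.
have : (\int[mu]_(s in `[t, +oo[) (damped b eta al' ga' s)%:E)%E \is a fin_num.
  by apply: integrable_fin_num => //; exact: integrable_damped.
move: (\int[mu]_(s in _) _)%E => [r _|//|//].
by rewrite -EFinD => -[H]; congr EFin; lra.
Qed.

(** Multiplying g by a slowly varying factor gives a Hartley coefficient over
    ]0, +oo[ bounded by the average for g: write the factor as the integral of its
    derivative and exchange the order of integration. *)
Lemma hartley_damped_le a k g (b eta al ga : R) : 0 < a -> a / 2 <= b ->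
  `|b * al - ga * eta| + `|b * ga + al * eta| <= 10 * a ->
  measurable_fun setT g ->
  (\int[mu]_(t in D) (expR (- (a / 2 * t)) * `|g t|)%:E < +oo)%E ->
  (`|\int[mu]_(t in D) (hartley a k t * (damped b eta al ga t * g t))%:E|
    <= hartley_average a k g)%E.
Proof.
move=> a0 ab ha mg gfin; have mD : measurable D by exact: measurable_itv.
have b0 : 0 < b by apply: lt_le_trans ab; rewrite divr_gt0.
have a20 : 0 < a / 2 by rewrite divr_gt0.
pose h s := damped b eta (b * al - ga * eta) (b * ga + al * eta) s.
have mh : @measurable_fun _ _ mR mR setT h by exact: measurable_damped.
have hw s : 0 <= s -> `|h s| <= laplace_weight a s.
  move=> s0; apply: (le_trans (damped_le _ _ _ _ _)).
  apply: ler_pM; rewrite ?expR_ge0 ?addr_ge0// ler_expR lerN2.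
  by rewrite ler_wpM2r.
have meg : @measurable_fun _ _ mR mR setT (fun t => hartley a k t * g t).
  by apply: measurable_funM => //; exact: measurable_hartley.
pose F (z : mR * mR) : R :=
  if (0 < z.1) && (z.1 <= z.2) then (hartley a k z.1 * g z.1) * h z.2 else 0.
have m1 : measurable_fun setT (fun z : mR * mR => z.1) by exact: measurable_fst.
have m2 : measurable_fun setT (fun z : mR * mR => z.2) by exact: measurable_snd.
have mF : measurable_fun setT F.
  apply: measurable_fun_ifT => //.
  - apply: measurable_and; first exact: measurable_fun_ltr.
    exact: measurable_fun_ler.
  - by apply: measurable_funM; [exact: (measurableT_comp meg m1)|exact: (measurableT_comp mh m2)].
have mEF : measurable_fun setT (EFin \o F) by exact/measurable_EFinP.
have row (t : R) (f : R -> R) :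
    (\int[mu]_s (if (0 < t)%R && (t <= s)%R then f s else 0%R)%:E =
    if (0 < t)%R then \int[mu]_(s in `[t, +oo[) (f s)%:E else 0)%E.
  case: ltP => t0 /=; last by rewrite integral0.
  rewrite [RHS]integral_mkcond; apply: eq_integral => s _.
  by rewrite patchE mem_setE in_itv/= andbT; case: ifP.
have mt t : measurable (`[t, +oo[%classic : set mR) by exact: measurable_itv.
have mw : measurable_fun D (fun t => 40 * (expR (- (a / 2 * t)) * `|g t|)).
  apply: measurable_funM => //; apply: measurable_funM; first exact: measurable_expRN.
  by apply: measurableT_comp => //; exact: (measurable_funTS mg).
have rowle t : 0 < t -> (\int[mu]_(s in `[t, +oo[) (`|hartley a k t * g t| * `|h s|)%:E <=
    (40 * (expR (- (a / 2 * t)) * `|g t|))%:E)%E.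
  move=> t0.
  apply: (@le_trans _ _ (\int[mu]_(s in `[t, +oo[)
     (2 * `|g t| * (10 * a) * expR (- (a / 2 * s)))%:E)%E).
    apply: ge0_le_integralR => //.
    - apply: measurable_funM => //; apply: measurableT_comp => //; exact: (measurable_funTS mh).
    - by apply: measurable_funM => //; exact: measurable_expRN.
    move=> s; rewrite /= in_itv/= andbT => ts; rewrite -[leRHS]mulrA; apply: ler_pM => //.
      by rewrite normrM ler_wpM2r// hartley_le2.
    by apply: hw; rewrite (le_trans _ ts)// ltW.
  rewrite ge0_integralZlR//; last 2 first.
  - exact: measurable_expRN.
  - by rewrite mulr_ge0// mulr_ge0// ltW.
  rewrite integral_expRN// -EFinM lee_fin le_eqVlt; apply/orP; left; apply/eqP.
  by field; exact: lt0r_neq0.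
have iF : (mu \x mu)%E.-integrable setT (EFin \o F).
  apply/integrable12ltyP => //.
  apply: (@le_lt_trans _ _ (\int[mu]_(t in D) (40 * (expR (- (a / 2 * t)) * `|g t|))%:E)%E).
    rewrite [leRHS]integral_mkcond; apply: ge0_le_integral => //.
    - by move=> t _; exact: integral_ge0.
    - apply: (measurable_fun_fubini_tonelli_F (fun z => `|(EFin \o F) z|%E)) => //.
      exact: measurableT_comp.
    - by apply/(measurable_restrictT _ mD)/measurable_EFinP; exact: mw.
    move=> t _; rewrite patchE mem_setE in_itv/= andbT.
    apply: (@le_trans _ _ (\int[mu]_s (if (0 < t)%R && (t <= s)%R then
       (`|hartley a k t * g t| * `|h s|)%R else 0%R)%:E)%E).
      rewrite le_eqVlt; apply/orP; left; apply/eqP; apply: eq_integral => s _.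
      by rewrite /F/=; case: ifP => _; rewrite ?normrM ?normr0.
    by rewrite row; case: ltP => // t0; exact: rowle.
  rewrite ge0_integralZlR//.
  - by rewrite lte_mul_pinfty.
  - apply: measurable_funM; first exact: measurable_expRN.
    by apply: measurableT_comp => //; exact: (measurable_funTS mg).
have ieg : mu.-integrable D (EFin \o (fun t => expR (- (a / 2 * t)) * `|g t|)).
  apply: ge0_integrableR => //.
    apply: measurable_funM; first exact: measurable_expRN.
    by apply: measurableT_comp => //; exact: (measurable_funTS mg).
have ig s : mu.-integrable (`]0%R, s]%classic : set mR) (EFin \o g).
  have ms : measurable (`]0%R, s]%classic : set mR) by exact: measurable_itv.
  apply: (@le_integrableR _ _ _ mu _ ms _ (fun t => expR (a / 2 * s) * (expR (- (a / 2 * t)) * `|g t|))).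
  - exact: (measurable_funTS mg).
  - move=> t; rewrite /= in_itv/= => /andP[t0 ts].
    rewrite mulrA -expRD ler_peMl// -[leLHS]expR0 ler_expR -mulrBr.
    by rewrite mulr_ge0 ?subr_ge0// ltW.
  - apply: (@integrableS _ _ _ mu D _ _ mD ms).
      by move=> t; rewrite /= !in_itv/= andbT => /andP[].
    have := @integrableZl _ _ _ mu D mD (expR (a / 2 * s)) _ ieg.
    by apply: eq_integrable => // t _; rewrite /= EFinM.
have lhs : (\int[mu]_t \int[mu]_s (F (t, s))%:E =
   \int[mu]_(t in D) (hartley a k t * (damped b eta al ga t * g t))%:E)%E.
  rewrite [RHS]integral_mkcond; apply: eq_integral => t _.
  rewrite patchE mem_setE in_itv/= andbT /F/= row; case: ltP => // t0.
  under eq_integral do rewrite EFinM.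
  rewrite integralZl//; last exact: integrable_damped.
  by rewrite integral_damped// -EFinM; congr EFin; ring.
have rhs s : (\int[mu]_t (F (t, s))%:E = (h s * hartley_coef a k g s)%:E)%E.
  transitivity (\int[mu]_(t in `]0%R, s]) ((h s)%:E * (hartley a k t * g t)%:E))%E.
    rewrite [RHS]integral_mkcond; apply: eq_integral => t _.
    rewrite patchE mem_setE in_itv/= /F/=; case: ifP => // _.
    by rewrite -EFinM mulrC.
  have ihg := integrable_hartleyM a k (measurable_itv _) (ig s).
  rewrite (@integralZl _ _ _ mu _ (measurable_itv _) _ ihg) [RHS]EFinM; congr (_ * _)%E.
  by rewrite /hartley_coef /Rintegral fineK//; exact: integrable_fin_num.
have := Fubini iF; rewrite /= lhs => ->.
under eq_integral do rewrite rhs.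
have mhG : measurable_fun setT (fun s => (h s * hartley_coef a k g s)%:E).
  apply/measurable_EFinP/measurable_funM => //; exact: (measurable_hartley_coef _ _ mg).
apply: (le_trans (le_abse_integral mu measurableT mhG)).
rewrite /hartley_average [leRHS]integral_mkcond; apply: ge0_le_integral => //.
- exact: measurableT_comp.
- apply/(measurable_restrictT _ mD)/measurable_EFinP.
  apply: measurable_funM; first exact: measurable_laplace_weight.
  exact: measurable_abs_hartley_coef.
move=> s _; rewrite patchE mem_setE in_itv/= andbT; case: ltP => s0.
  by rewrite lee_fin normrM ler_wpM2r// hw// ltW.
rewrite /hartley_coef set_itv_ge ?bnd_simp -?leNgt// Rintegral_set0.
by rewrite mulr0 normr0.
Qed.

End separation.

(** * The Laplace transform on a box *)

Section laplace_on_boxes.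
Context {R : realType}.
Notation mu := (@lebesgue_measure R).
Notation mR := (measurableTypeR R).
Notation D := (`]0%R, +oo[%classic : set (measurableTypeR R)).
Implicit Types (a s t : R) (j k : int) (g u : R -> R).

(** The interpolated bound with P = 0 allowed, by letting P tend to 0. *)
Lemma sum_powR_hartley_average (q a P : R) (A : seq int) g : 2 <= q -> 0 < a -> 0 <= P ->
  uniq A -> measurable_fun setT g ->
  (\int[mu]_(t in D) (`|g t| `^ (q / (q - 1)))%:E <= P%:E)%E ->
  (forall k, k \in A -> (hartley_average a k g < +oo)%E) /\
  \sum_(k <- A) fine (hartley_average a k g) `^ q <= hartley_const q / a * P `^ (q - 1).
Proof.
move=> q2 a0; rewrite le_eqVlt => /predU1P[<- uA mg gP|P0]; last first.
  exact: sum_powR_hartley_average_gt0.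
have H e : 0 < e -> (\int[mu]_(t in D) (`|g t| `^ (q / (q - 1)))%:E <= e%:E)%E.
  by move=> e0; rewrite (le_trans gP)// lee_fin ltW.
split; first by have [] := sum_powR_hartley_average_gt0 q2 a0 ltr01 uA mg (H _ ltr01).
rewrite powR0; last by rewrite gt_eqF//; lra.
rewrite mulr0; set S := \sum_(k <- A) _; rewrite leNgt; apply/negP => S0.
have c0 : 0 < hartley_const q / a by rewrite divr_gt0// hartley_const_gt0.
pose e := S / (2 * (hartley_const q / a)).
have e0 : 0 < e by rewrite divr_gt0// mulr_gt0.
have q10 : 0 < q - 1 by lra.
have [_] := sum_powR_hartley_average_gt0 q2 a0 (powR_gt0 (q - 1)^-1 e0) uA mg (H _ (powR_gt0 _ e0)).
rewrite -/S -powRrM mulVf ?lt0r_neq0// powRr1 ?(ltW e0)// /e.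
rewrite (_ : _ * _ = S / 2); last by field; rewrite !lt0r_neq0// hartley_const_gt0.
lra.
Qed.

(** The oscillation at frequency 2 pi a k + eta is split into hartley a k and
    hartley a (- k) times oscillations at the low frequency eta. *)
Lemma trig_split a k (eta c d t : R) :
  c * cos ((2 * pi * a * k%:~R + eta) * t) + d * sin ((2 * pi * a * k%:~R + eta) * t) =
  hartley a k t * ((c + d) / 2 * cos (eta * t) + (d - c) / 2 * sin (eta * t)) +
  hartley a (- k) t * ((c - d) / 2 * cos (eta * t) + (c + d) / 2 * sin (eta * t)).
Proof.
rewrite /hartley mulrDl cosD sinD.
have -> : 2 * pi * a * (- k)%:~R * t = - (2 * pi * a * k%:~R * t) by rewrite rmorphN; ring.
by rewrite cosN sinN; field.
Qed.

Lemma pi_le4 : pi <= 4 :> R.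
Proof. by have /andP[_] := pihalf_02 R; rewrite ltr_pdivrMr// => /ltW; lra. Qed.

(** The weighted function called g above. *)
Definition damp a u t : R := expR (- (a / 2 * t)) * u t.

(** The bound does not depend on the point (x, y) of the box. *)
Lemma trig_laplace_le a k u (x y c d : R) : 0 < a -> a <= x -> x < 2 * a ->
  2 * pi * a * k%:~R <= y -> y < 2 * pi * a * (k + 1)%:~R ->
  `|c| + `|d| <= 1 ->
  measurable_fun setT u ->
  (\int[mu]_(t in D) (expR (- (a * t)) * `|u t|)%:E < +oo)%E ->
  (`|\int[mu]_(t in D) (expR (- (x * t)) * (c * cos (y * t) + d * sin (y * t)) * u t)%:E|
    <= hartley_average a k (damp a u) + hartley_average a (- k) (damp a u))%E.
Proof.
move=> a0 ax x2a ky yk cd hu ufin; pose g := damp a u.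
have mD : measurable D by exact: measurable_itv.
pose eta := y - 2 * pi * a * k%:~R.
have eta0 : 0 <= eta by rewrite subr_ge0.
have eta8 : eta <= 8 * a.
  apply: (@le_trans _ _ (2 * pi * a)).
    by rewrite /eta lerBlDr (le_trans (ltW yk))// rmorphD/= mulrDr mulr1 addrC.
  by rewrite ler_pM2r//; have := pi_le4; lra.
pose b := x - a / 2.
have b1 : a / 2 <= b by rewrite /b; lra.
have b2 : b <= 3 / 2 * a by rewrite /b; lra.
have mg : measurable_fun setT g by apply: measurable_funM => //; exact: measurable_expRN.
have gfin : (\int[mu]_(t in D) (expR (- (a / 2 * t)) * `|g t|)%:E < +oo)%E.
  apply: le_lt_trans ufin; rewrite le_eqVlt; apply/orP; left; apply/eqP.
  apply: eq_integral => t _; rewrite /g /damp normrM ger0_norm ?expR_ge0// mulrA -expRD.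
  by congr (expR _ * _)%:E; field.
have coef (al ga : R) : `|al| <= 2^-1 -> `|ga| <= 2^-1 ->
    `|b * al - ga * eta| + `|b * ga + al * eta| <= 10 * a.
  move=> hal hga; have b0 : 0 <= b by rewrite (le_trans _ b1)// divr_ge0// ltW.
  have := ler_normB (b * al) (ga * eta); have := ler_normD (b * ga) (al * eta).
  rewrite !normrM (ger0_norm b0) (ger0_norm eta0).
  move: (`|al|) (`|ga|) (normr_ge0 al) (normr_ge0 ga) hal hga => r s; nra.
pose P k' (al ga : R) t := hartley a k' t * (damped b eta al ga t * g t).
have iP k' (al ga : R) : `|al| <= 2^-1 -> `|ga| <= 2^-1 -> mu.-integrable D (EFin \o P k' al ga).
  move=> hal hga.
  apply: (@le_integrableR _ _ _ mu D mD _ (fun t => 2 * (expR (- (a / 2 * t)) * `|g t|))).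
  - apply: measurable_funM; first exact: measurable_hartley.
    by apply: measurable_funM; [exact: measurable_damped|exact: (measurable_funTS mg)].
  - move=> t; rewrite /= in_itv/= andbT => t0.
    rewrite /P normrM; apply: ler_pM => //; first exact: hartley_le2.
    rewrite normrM ler_wpM2r//; apply: (le_trans (damped_le _ _ _ _ _)).
    apply: (@le_trans _ _ (1 * expR (- (b * t)))).
      by rewrite ler_wpM2r ?expR_ge0//; lra.
    by rewrite mul1r ler_expR lerN2 ler_wpM2r// ltW.
  - have ig : mu.-integrable D (EFin \o (fun t => expR (- (a / 2 * t)) * `|g t|)).
      apply: ge0_integrableR => //.
      apply: measurable_funM; first exact: measurable_expRN.
      by apply: measurableT_comp => //; exact: (measurable_funTS mg).
    have := @integrableZl _ _ _ mu D mD 2 _ ig.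
    by apply: eq_integrable => // t _; rewrite /= EFinM.
have := ler_norm c; have := ler_norm d; have := ler_norm (- c); have := ler_norm (- d).
rewrite !normrN => d2 c2 d1 c1.
have h1 : `|(c + d) / 2| <= 2^-1 by rewrite ler_norml; apply/andP; split; lra.
have h2 : `|(d - c) / 2| <= 2^-1 by rewrite ler_norml; apply/andP; split; lra.
have h3 : `|(c - d) / 2| <= 2^-1 by rewrite ler_norml; apply/andP; split; lra.
rewrite (_ : (\int[mu]_(t in D) _)%E = (\int[mu]_(t in D) (P k ((c + d) / 2) ((d - c) / 2) t)%:E
   + \int[mu]_(t in D) (P (- k) ((c - d) / 2) ((c + d) / 2) t)%:E)%E); last first.
  rewrite -integralD//; [|exact: iP|exact: iP].
  apply: eq_integral => t _; rewrite -EFinD; congr EFin.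
  have -> : y = 2 * pi * a * k%:~R + eta by rewrite /eta; ring.
  rewrite trig_split /P /damped /g /damp.
  have -> : expR (- (x * t)) = expR (- (b * t)) * expR (- (a / 2 * t)).
    by rewrite -expRD; congr expR; rewrite /b; field.
  ring.
apply: (le_trans (lee_abs_add _ _)); apply: leeD.
  by apply: hartley_damped_le => //; exact: coef.
by apply: hartley_damped_le => //; exact: coef.
Qed.

End laplace_on_boxes.

Section laplace_bounds.
Context {R : realType}.
Notation mu := (@lebesgue_measure R).
Notation mR := (measurableTypeR R).
Notation D := (`]0%R, +oo[%classic : set (measurableTypeR R)).
Notation Re := complex.Re.
Notation Im := complex.Im.
Implicit Types (a s t x y : R) (j k : int) (g u : R -> R) (f : R -> R[i]).

Lemma laplace_kernel_Re f (z : R * R) t : Re (laplace_kernel f z t) =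
  expR (- (z.1 * t)) * (cos (z.2 * t) * Re (f t) + sin (z.2 * t) * Im (f t)).
Proof.
rewrite /laplace_kernel /cexp; case: (f t) => u v /=.
by rewrite !mulr0 !mul0r !subr0 !add0r cosN sinN; ring.
Qed.

Lemma laplace_kernel_Im f (z : R * R) t : Im (laplace_kernel f z t) =
  expR (- (z.1 * t)) * (cos (z.2 * t) * Im (f t) - sin (z.2 * t) * Re (f t)).
Proof.
rewrite /laplace_kernel /cexp; case: (f t) => u v /=.
by rewrite !mulr0 !mul0r !subr0 !add0r cosN sinN; ring.
Qed.

Lemma normc_le (w : R[i]) : Normc.normc w <= `|Re w| + `|Im w|.
Proof.
case: w => u v /=; rewrite -(ler_sqr (sqrtr_ge0 _))//; last by rewrite nnegrE addr_ge0.
rewrite sqr_sqrtr ?addr_ge0 ?sqr_ge0// -(real_normK (num_real u)) -(real_normK (num_real v)).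
have := normr_ge0 u; have := normr_ge0 v; nra.
Qed.

Lemma Re_le_normc (w : R[i]) : `|Re w| <= Normc.normc w.
Proof.
case: w => u v /=; rewrite -sqrtr_sqr ler_wsqrtr// lerDl sqr_ge0//.
Qed.

Lemma Im_le_normc (w : R[i]) : `|Im w| <= Normc.normc w.
Proof.
case: w => u v /=; rewrite -sqrtr_sqr ler_wsqrtr// lerDr sqr_ge0//.
Qed.

Lemma measurable_normc d (T : measurableType d) (E : set T) (f : T -> R[i]) :
  cmeasurable_fun E f -> measurable_fun E (fun z => Normc.normc (f z)).
Proof.
move=> [mr mi].
rewrite (_ : (fun z => _) = Num.sqrt \o (fun z => Re (f z) ^+ 2 + Im (f z) ^+ 2)); last first.
  by apply/funext => t /=; case: (f t).
apply: measurableT_comp; first by apply: continuous_measurable_fun; exact: sqrt_continuous.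
by apply: measurable_funD; exact: measurable_funX.
Qed.

Lemma normc_ge0 (w : R[i]) : 0 <= Normc.normc w.
Proof. by case: w => u v /=; exact: sqrtr_ge0. Qed.

(** The real and imaginary parts of the Laplace kernel are sums of two functions
    of this form, with u the real or the imaginary part of f. *)
Definition oscillation (c d x y : R) u t : R :=
  expR (- (x * t)) * (c * cos (y * t) + d * sin (y * t)) * u t.

Lemma oscillation_le c d x y u a t : 0 <= t -> a <= x -> `|c| + `|d| <= 1 ->
  `|oscillation c d x y u t| <= expR (- (a * t)) * `|u t|.
Proof.
move=> t0 ax cd; rewrite /oscillation normrM ler_wpM2r//.
apply: (le_trans (damped_le x y c d t)).
apply: (@le_trans _ _ (1 * expR (- (x * t)))); first by rewrite ler_wpM2r ?expR_ge0.
by rewrite mul1r ler_expR lerN2 ler_wpM2r.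
Qed.

Lemma measurable_oscillation c d x y u (E : set mR) : measurable_fun E u ->
  measurable_fun E (oscillation c d x y u).
Proof. by move=> m_u; apply: measurable_funM => //; exact: (measurable_damped x y c d). Qed.

Lemma integrable_oscillation c d x y u a : a <= x -> `|c| + `|d| <= 1 ->
  measurable_fun setT u ->
  (\int[mu]_(t in D) (expR (- (a * t)) * `|u t|)%:E < +oo)%E ->
  mu.-integrable D (EFin \o oscillation c d x y u).
Proof.
move=> ax cd m_u ufin; have mD : measurable D by exact: measurable_itv.
apply: (@le_integrableR _ _ _ mu D mD _ (fun t => expR (- (a * t)) * `|u t|)).
- by apply: measurable_oscillation; exact: (measurable_funTS m_u).
- by move=> t; rewrite /= in_itv/= andbT => /ltW t0; exact: oscillation_le.
- apply: ge0_integrableR => //; apply: measurable_funM; first exact: measurable_expRN.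
  by apply: measurableT_comp => //; exact: (measurable_funTS m_u).
Qed.

(** The bound of trig_laplace_le as a real number. *)
Definition box_average a u k : R :=
  fine (hartley_average a k (damp a u)) + fine (hartley_average a (- k) (damp a u)).

Lemma Rintegral_oscillation_le a k u (x y c d : R) : 0 < a -> a <= x -> x < 2 * a ->
  2 * pi * a * k%:~R <= y -> y < 2 * pi * a * (k + 1)%:~R ->
  `|c| + `|d| <= 1 -> measurable_fun setT u ->
  (\int[mu]_(t in D) (expR (- (a * t)) * `|u t|)%:E < +oo)%E ->
  (hartley_average a k (damp a u) < +oo)%E -> (hartley_average a (- k) (damp a u) < +oo)%E ->
  `|\int[mu]_(t in D) oscillation c d x y u t| <= box_average a u k.
Proof.
move=> a0 ax x2a ky yk cd m_u ufin h1 h2; have mD : measurable D by exact: measurable_itv.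
have H := trig_laplace_le a0 ax x2a ky yk cd m_u ufin.
have f1 := hartley_average_fin_num a0 h1; have f2 := hartley_average_fin_num a0 h2.
rewrite -lee_fin [leRHS](_ : _ = hartley_average a k (damp a u) +
    hartley_average a (- k) (damp a u))%E; last first.
  by rewrite /box_average EFinD; congr (_ + _)%E; exact: fineK.
apply: le_trans H; rewrite /Rintegral -fine_abse; last first.
  by apply: integrable_fin_num => //; exact: (integrable_oscillation _ ax).
rewrite fineK// abse_fin_num.
by apply: integrable_fin_num => //; exact: (integrable_oscillation _ ax).
Qed.

(** The real and imaginary parts of f, extended by 0 outside ]0, +oo[ so that
    they are measurable on the whole line. *)
Definition Re_part f : R -> R := (fun t => Re (f t)) \_ (`]0%R, +oo[%classic : set R).
Definition Im_part f : R -> R := (fun t => Im (f t)) \_ (`]0%R, +oo[%classic : set R).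

Lemma Re_partE f t : 0 < t -> Re_part f t = Re (f t).
Proof. by move=> t0; rewrite /Re_part patchE mem_setE in_itv/= t0. Qed.

Lemma Im_partE f t : 0 < t -> Im_part f t = Im (f t).
Proof. by move=> t0; rewrite /Im_part patchE mem_setE in_itv/= t0. Qed.

Lemma measurable_Re_part f : cmeasurable_fun (`]0%R, +oo[%classic : set R) f ->
  measurable_fun setT (Re_part f).
Proof. by move=> [mr _]; apply/(measurable_restrictT _ (measurable_itv _)). Qed.

Lemma measurable_Im_part f : cmeasurable_fun (`]0%R, +oo[%classic : set R) f ->
  measurable_fun setT (Im_part f).
Proof. by move=> [_ mi]; apply/(measurable_restrictT _ (measurable_itv _)). Qed.

Lemma laplace_kernel_ReE f z t : 0 < t -> Re (laplace_kernel f z t) =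
  oscillation 1 0 z.1 z.2 (Re_part f) t + oscillation 0 1 z.1 z.2 (Im_part f) t.
Proof.
by move=> t0; rewrite laplace_kernel_Re /oscillation Re_partE// Im_partE//; ring.
Qed.

Lemma laplace_kernel_ImE f z t : 0 < t -> Im (laplace_kernel f z t) =
  oscillation 1 0 z.1 z.2 (Im_part f) t + oscillation 0 (-1) z.1 z.2 (Re_part f) t.
Proof.
by move=> t0; rewrite laplace_kernel_Im /oscillation Re_partE// Im_partE//; ring.
Qed.

Section fixed_box.
Variables (f : R -> R[i]) (a : R).
Hypotheses (mf : cmeasurable_fun (`]0%R, +oo[%classic : set R) f) (a0 : 0 < a).
Hypothesis ufin : (\int[mu]_(t in D) (expR (- (a * t)) * `|Re_part f t|)%:E < +oo)%E.
Hypothesis vfin : (\int[mu]_(t in D) (expR (- (a * t)) * `|Im_part f t|)%:E < +oo)%E.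

Lemma cintegrable_laplace_kernel z : a <= z.1 -> cintegrable `]0, +oo[ (laplace_kernel f z).
Proof.
move=> az; have mD : measurable D by exact: measurable_itv.
have m_u := measurable_Re_part mf; have m_v := measurable_Im_part mf.
have n10 : `|1 : R| + `|0 : R| <= 1 by rewrite normr1 normr0 addr0.
have n01 : `|0 : R| + `|1 : R| <= 1 by rewrite normr1 normr0 add0r.
have n0N1 : `|0 : R| + `|-1 : R| <= 1 by rewrite normrN1 normr0 add0r.
split.
- have := integrableD mD (integrable_oscillation z.2 az n10 m_u ufin)
    (integrable_oscillation z.2 az n01 m_v vfin).
  apply: eq_integrable => // t; rewrite inE/= in_itv/= andbT => t0.
  by rewrite -EFinD laplace_kernel_ReE.
- have := integrableD mD (integrable_oscillation z.2 az n10 m_v vfin)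
    (integrable_oscillation z.2 az n0N1 m_u ufin).
  apply: eq_integrable => // t; rewrite inE/= in_itv/= andbT => t0.
  by rewrite -EFinD laplace_kernel_ImE.
Qed.

(** A bound for the modulus of the Laplace transform of f on the k-th box at
    scale a. *)
Definition box_bound k : R := 2 * (box_average a (Re_part f) k + box_average a (Im_part f) k).

Lemma laplace_le_box_bound k (z : R * R) : a <= z.1 -> z.1 < 2 * a ->
  2 * pi * a * k%:~R <= z.2 -> z.2 < 2 * pi * a * (k + 1)%:~R ->
  (forall k, hartley_average a k (damp a (Re_part f)) < +oo)%E ->
  (forall k, hartley_average a k (damp a (Im_part f)) < +oo)%E ->
  Normc.normc (laplace f z) <= box_bound k.
Proof.
move=> az z2a kz zk hu hv; have mD : measurable D by exact: measurable_itv.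
have m_u := measurable_Re_part mf; have m_v := measurable_Im_part mf.
have n10 : `|1 : R| + `|0 : R| <= 1 by rewrite normr1 normr0 addr0.
have n01 : `|0 : R| + `|1 : R| <= 1 by rewrite normr1 normr0 add0r.
have n0N1 : `|0 : R| + `|-1 : R| <= 1 by rewrite normrN1 normr0 add0r.
apply: (le_trans (normc_le _)).
have twice (r s : R) : 2 * (r + s) = (r + s) + (s + r) by ring.
rewrite /box_bound twice.
apply: lerD.
- rewrite /laplace /cintegral/=.
  rewrite (_ : \int[mu]_(t in _) _ = \int[mu]_(t in D) oscillation 1 0 z.1 z.2 (Re_part f) t +
      \int[mu]_(t in D) oscillation 0 1 z.1 z.2 (Im_part f) t); last first.
    rewrite -RintegralD//; [|exact: integrable_oscillation az n10 m_u ufin|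
      exact: integrable_oscillation az n01 m_v vfin].
    apply: eq_Rintegral => t; rewrite inE/= in_itv/= andbT => t0.
    exact: laplace_kernel_ReE.
  by apply: (le_trans (ler_normD _ _)); apply: lerD;
    apply: Rintegral_oscillation_le.
- rewrite /laplace /cintegral/=.
  rewrite (_ : \int[mu]_(t in _) _ = \int[mu]_(t in D) oscillation 1 0 z.1 z.2 (Im_part f) t +
      \int[mu]_(t in D) oscillation 0 (-1) z.1 z.2 (Re_part f) t); last first.
    rewrite -RintegralD//; [|exact: integrable_oscillation az n10 m_v vfin|
      exact: integrable_oscillation az n0N1 m_u ufin].
    apply: eq_Rintegral => t; rewrite inE/= in_itv/= andbT => t0.
    exact: laplace_kernel_ImE.
  by apply: (le_trans (ler_normD _ _)); apply: lerD;
    apply: Rintegral_oscillation_le.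
Qed.

End fixed_box.
End laplace_bounds.

(** * Measurability and integrability of the Laplace transform *)

Section laplace_integrability.
Context {R : realType}.
Notation mu := (@lebesgue_measure R).
Notation mR := (measurableTypeR R).
Notation D := (`]0%R, +oo[%classic : set (measurableTypeR R)).
Notation Re := complex.Re.
Notation Im := complex.Im.
Implicit Types (a s t x y : R) (j k : int) (g u : R -> R) (f : R -> R[i]).

Lemma cmeasurable_laplace f (E : set (R * R)) :
  cmeasurable_fun (`]0%R, +oo[%classic : set R) f -> cmeasurable_fun E (laplace f).
Proof.
move=> mf; have m_u := measurable_Re_part mf; have m_v := measurable_Im_part mf.
have m1 : measurable_fun setT (fun w : (R * R) * mR => w.1.1).
  exact: (measurableT_comp measurable_fst measurable_fst).
have m2 : measurable_fun setT (fun w : (R * R) * mR => w.1.2).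
  exact: (measurableT_comp measurable_snd measurable_fst).
have m3 : measurable_fun setT (fun w : (R * R) * mR => w.2) by exact: measurable_snd.
have mosc (c d : R) (u : R -> R) : measurable_fun setT u ->
    measurable_fun setT (fun w : (R * R) * mR => oscillation c d w.1.1 w.1.2 u w.2).
  move=> m_u'; have mu' : @measurable_fun _ _ mR R setT u by exact: m_u'.
  apply: measurable_funM; last exact: (measurableT_comp mu' m3).
  apply: measurable_funM.
    apply: (measurableT_comp (@measurable_expR R)); apply: measurableT_comp => //.
    by apply: measurable_funM => //; exact: m3.
  have m23 : measurable_fun setT (fun w : (R * R) * mR => w.1.2 * w.2).
    by apply: measurable_funM => //; exact: m3.
  apply: measurable_funD; apply: measurable_funM => //.
    by apply: (measurableT_comp _ m23); apply: continuous_measurable_fun; exact: continuous_cos.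
  by apply: (measurableT_comp _ m23); apply: continuous_measurable_fun; exact: continuous_sin.
split.
- rewrite (_ : (fun z => _) = fun z => \int[mu]_t
    (oscillation 1 0 z.1 z.2 (Re_part f) t + oscillation 0 1 z.1 z.2 (Im_part f) t)).
    apply: measurable_funTS; apply: (measurable_Rintegral_param
      (F := fun w : (R * R) * mR => oscillation 1 0 w.1.1 w.1.2 (Re_part f) w.2 +
         oscillation 0 1 w.1.1 w.1.2 (Im_part f) w.2)).
    by apply: measurable_funD; exact: mosc.
  apply/funext => z; rewrite /laplace/= Rintegral_mkcond; apply: eq_Rintegral => t _.
  rewrite patchE mem_setE in_itv/= andbT; case: ltP => t0; first exact: laplace_kernel_ReE.
  by rewrite /oscillation /Re_part /Im_part !patchE !mem_setE !in_itv/= andbT ltNge t0/= !mulr0 addr0.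
- rewrite (_ : (fun z => _) = fun z => \int[mu]_t
    (oscillation 1 0 z.1 z.2 (Im_part f) t + oscillation 0 (-1) z.1 z.2 (Re_part f) t)).
    apply: measurable_funTS; apply: (measurable_Rintegral_param
      (F := fun w : (R * R) * mR => oscillation 1 0 w.1.1 w.1.2 (Im_part f) w.2 +
         oscillation 0 (-1) w.1.1 w.1.2 (Re_part f) w.2)).
    by apply: measurable_funD; exact: mosc.
  apply/funext => z; rewrite /laplace/= Rintegral_mkcond; apply: eq_Rintegral => t _.
  rewrite patchE mem_setE in_itv/= andbT; case: ltP => t0; first exact: laplace_kernel_ImE.
  by rewrite /oscillation /Re_part /Im_part !patchE !mem_setE !in_itv/= andbT ltNge t0/= !mulr0 addr0.
Qed.

Lemma powR_add4_le (q h1 h2 h3 h4 : R) : 0 <= q -> 0 <= h1 -> 0 <= h2 -> 0 <= h3 -> 0 <= h4 ->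
  (h1 + h2 + h3 + h4) `^ q <= 4 `^ q * (h1 `^ q + h2 `^ q + h3 `^ q + h4 `^ q).
Proof.
move=> q0 p1 p2 p3 p4.
have H M : 0 <= M -> h1 <= M -> h2 <= M -> h3 <= M -> h4 <= M ->
    (h1 + h2 + h3 + h4) `^ q <= 4 `^ q * M `^ q.
  move=> M0 l1 l2 l3 l4; rewrite -powRM//; apply: ge0_ler_powR; rewrite ?nnegrE//; lra.
have P1 := powR_ge0 h1 q; have P2 := powR_ge0 h2 q.
have P3 := powR_ge0 h3 q; have P4 := powR_ge0 h4 q.
have [l12|/ltW l12] := leP h1 h2; have [l34|/ltW l34] := leP h3 h4.
- have [l|/ltW l] := leP h2 h4.
  + by apply: (le_trans (H h4 _ _ _ _ _)) => //; rewrite ?ler_wpM2l ?powR_ge0//; lra.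
  + by apply: (le_trans (H h2 _ _ _ _ _)) => //; rewrite ?ler_wpM2l ?powR_ge0//; lra.
- have [l|/ltW l] := leP h2 h3.
  + by apply: (le_trans (H h3 _ _ _ _ _)) => //; rewrite ?ler_wpM2l ?powR_ge0//; lra.
  + by apply: (le_trans (H h2 _ _ _ _ _)) => //; rewrite ?ler_wpM2l ?powR_ge0//; lra.
- have [l|/ltW l] := leP h1 h4.
  + by apply: (le_trans (H h4 _ _ _ _ _)) => //; rewrite ?ler_wpM2l ?powR_ge0//; lra.
  + by apply: (le_trans (H h1 _ _ _ _ _)) => //; rewrite ?ler_wpM2l ?powR_ge0//; lra.
- have [l|/ltW l] := leP h1 h3.
  + by apply: (le_trans (H h3 _ _ _ _ _)) => //; rewrite ?ler_wpM2l ?powR_ge0//; lra.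
  + by apply: (le_trans (H h1 _ _ _ _ _)) => //; rewrite ?ler_wpM2l ?powR_ge0//; lra.
Qed.

Section fixed_scale.
Variables (q : R) (f : R -> R[i]) (a P : R).
Hypotheses (q2 : 2 <= q) (a0 : 0 < a) (P0 : 0 <= P).
Let p := q / (q - 1).
Hypothesis mf : cmeasurable_fun (`]0%R, +oo[%classic : set R) f.
Hypothesis fP : (\int[mu]_(t in D)
  (expR (- (p * (a / 2) * t)) * Normc.normc (f t) `^ p)%:E <= P%:E)%E.

Let p1 : 1 < p.
Proof. by have hq := q2; rewrite /p ltr_pdivlMr; lra. Qed.

Lemma integral_damp_le u : measurable_fun setT u ->
  (forall t, 0 < t -> `|u t| <= Normc.normc (f t)) ->
  (\int[mu]_(t in D) (`|damp a u t| `^ p)%:E <= P%:E)%E.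
Proof.
move=> m_u uf; apply: le_trans fP; have mD : measurable D by exact: measurable_itv.
apply: ge0_le_integralR => //.
- apply: (measurableT_comp (measurable_powR _)); apply: measurableT_comp => //.
  by apply: measurable_funM; [exact: measurable_expRN|exact: (measurable_funTS m_u)].
- apply: measurable_funM; first exact: measurable_expRN.
  by apply: (measurableT_comp (measurable_powR _)); exact: (measurable_normc mf).
move=> t; rewrite /= in_itv/= andbT => t0.
rewrite /damp normrM ger0_norm ?expR_ge0// powRM ?expR_ge0//.
rewrite -expRM (_ : - (a / 2 * t) * p = - (p * (a / 2) * t)); last by ring.
rewrite ler_wpM2l ?expR_ge0//; apply: ge0_ler_powR; rewrite ?nnegrE ?normc_ge0 ?uf//.
exact: ltW (lt_trans ltr01 p1).
Qed.

(** Absolute convergence of the Laplace integral, from the bound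
    x y <= x^p / p + y^q / q. *)
Lemma integral_damp_lty u : measurable_fun setT u ->
  (forall t, 0 < t -> `|u t| <= Normc.normc (f t)) ->
  (\int[mu]_(t in D) (expR (- (a * t)) * `|u t|)%:E < +oo)%E.
Proof.
move=> m_u uf; have mD : measurable D by exact: measurable_itv.
have hq := q2; have hp := p1; have q0 : 0 < q by lra.
have p0 : 0 < p by lra.
have qa0 : 0 < q * (a / 2) by rewrite mulr_gt0// divr_gt0.
apply: (@le_lt_trans _ _ (\int[mu]_(t in D) (`|damp a u t| `^ p + expR (- (q * (a / 2) * t)))%:E)%E).
  apply: ge0_le_integralR => //.
  - apply: measurable_funM; first exact: measurable_expRN.
    by apply: measurableT_comp => //; exact: (measurable_funTS m_u).
  - apply: measurable_funD; last exact: measurable_expRN.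
    apply: (measurableT_comp (measurable_powR _)); apply: measurableT_comp => //.
    by apply: measurable_funM; [exact: measurable_expRN|exact: (measurable_funTS m_u)].
  move=> t _.
  have -> : expR (- (a * t)) * `|u t| = `|damp a u t| * expR (- (a / 2 * t)).
    rewrite /damp normrM ger0_norm ?expR_ge0// mulrAC -expRD.
    by congr (expR _ * _); field.
  have pq : p^-1 + q^-1 = 1 by rewrite /p; field; rewrite !lt0r_neq0//; lra.
  apply: (le_trans (conjugate_powR (normr_ge0 _) (expR_ge0 _) p0 q0 pq)).
  apply: lerD; first by rewrite ler_pdivrMr// ler_peMr ?powR_ge0// ltW.
  rewrite ler_pdivrMr//; apply: (@le_trans _ _ (expR (- (q * (a / 2) * t)) * 1)).
    by rewrite mulr1 -expRM le_eqVlt; apply/orP; left; apply/eqP; congr expR; ring.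
  by rewrite ler_wpM2l ?expR_ge0//; lra.
under eq_integral do rewrite EFinD.
rewrite ge0_integralD//; last 2 first.
- apply/measurable_EFinP.
  apply: (measurableT_comp (measurable_powR _)); apply: measurableT_comp => //.
  by apply: measurable_funM; [exact: measurable_expRN|exact: (measurable_funTS m_u)].
- by apply/measurable_EFinP; exact: measurable_expRN.
rewrite lte_add_pinfty//.
  by rewrite (le_lt_trans (integral_damp_le m_u uf))// ltry.
by rewrite integral_expRN0// ltry.
Qed.

End fixed_scale.
End laplace_integrability.

Section sums_over_boxes.
Context {R : realType}.
Notation mu := (@lebesgue_measure R).
Notation mR := (measurableTypeR R).
Notation D := (`]0%R, +oo[%classic : set (measurableTypeR R)).
Notation Re := complex.Re.
Notation Im := complex.Im.

(** The factor 8 = 2 * 4 comes from the four averages of box_bound and its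
    leading factor 2, the factor 4 from adding up their sums. *)
Definition box_const (q : R) : R := 8 `^ q * 4 * hartley_const q.

Lemma sum_powR_add4 (q B : R) (h h' : int -> R) (A : seq int) : 0 <= q ->
  (forall k, 0 <= h k) -> (forall k, 0 <= h' k) ->
  \sum_(k <- A) h k `^ q <= B -> \sum_(k <- A) h (- k) `^ q <= B ->
  \sum_(k <- A) h' k `^ q <= B -> \sum_(k <- A) h' (- k) `^ q <= B ->
  \sum_(k <- A) (2 * (h k + h (- k) + (h' k + h' (- k)))) `^ q <= 8 `^ q * (4 * B).
Proof.
move=> q0 hp hp' s1 s2 s3 s4.
apply: (@le_trans _ _ (\sum_(k <- A) 8 `^ q *
    (h k `^ q + h (- k) `^ q + h' k `^ q + h' (- k) `^ q))).
  apply: ler_sum => k _; rewrite powRM ?addr_ge0//.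
  have -> : 8 `^ q = 2 `^ q * 4 `^ q :> R by rewrite -powRM//; congr (_ `^ _); ring.
  rewrite -mulrA; apply: ler_wpM2l; first exact: powR_ge0.
  by rewrite addrA; exact: powR_add4_le.
rewrite -mulr_sumr !big_split/=.
apply: ler_wpM2l; first exact: powR_ge0.
rewrite (_ : 4 * B = B + B + B + B); last by ring.
by rewrite !lerD.
Qed.

Lemma sum_box_bound (q a P : R) (f : R -> R[i]) : 2 <= q -> 0 < a -> 0 <= P ->
  cmeasurable_fun (`]0%R, +oo[%classic : set R) f ->
  (\int[mu]_(t in D) (expR (- (q / (q - 1) * (a / 2) * t)) *
     Normc.normc (f t) `^ (q / (q - 1)))%:E <= P%:E)%E ->
  [/\ forall k, (hartley_average a k (damp a (Re_part f)) < +oo)%E,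
      forall k, (hartley_average a k (damp a (Im_part f)) < +oo)%E &
      forall A : seq int, uniq A ->
        \sum_(k <- A) box_bound f a k `^ q <= box_const q / a * P `^ (q - 1)].
Proof.
move=> q2 a0 P0 mf fP.
have m_u := measurable_Re_part mf; have m_v := measurable_Im_part mf.
have uf t : 0 < t -> `|Re_part f t| <= Normc.normc (f t).
  by move=> t0; rewrite Re_partE// Re_le_normc.
have vf t : 0 < t -> `|Im_part f t| <= Normc.normc (f t).
  by move=> t0; rewrite Im_partE// Im_le_normc.
have uP := integral_damp_le q2 mf fP m_u uf.
have vP := integral_damp_le q2 mf fP m_v vf.
have mdu : measurable_fun setT (damp a (Re_part f)).
  by apply: measurable_funM; [exact: measurable_expRN|].
have mdv : measurable_fun setT (damp a (Im_part f)).
  by apply: measurable_funM; [exact: measurable_expRN|].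
have q0 : 0 <= q by lra.
split.
- move=> k; have [H _] := @sum_powR_hartley_average R q a P [:: k] _ q2 a0 P0 isT mdu uP.
  by apply: H; rewrite inE.
- move=> k; have [H _] := @sum_powR_hartley_average R q a P [:: k] _ q2 a0 P0 isT mdv vP.
  by apply: H; rewrite inE.
move=> A uA.
have uA' : uniq (map -%R A) by rewrite map_inj_uniq//; exact: oppr_inj.
have [_ s1] := sum_powR_hartley_average q2 a0 P0 uA mdu uP.
have [_ s2] := sum_powR_hartley_average q2 a0 P0 uA' mdu uP.
have [_ s3] := sum_powR_hartley_average q2 a0 P0 uA mdv vP.
have [_ s4] := sum_powR_hartley_average q2 a0 P0 uA' mdv vP.
rewrite big_map in s2; rewrite big_map in s4.
rewrite (_ : box_const q / a * P `^ (q - 1) =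
    8 `^ q * (4 * (hartley_const q / a * P `^ (q - 1))));
  last by rewrite /box_const; field; exact: lt0r_neq0.
apply: (sum_powR_add4 q0 _ _ s1 s2 s3 s4).
- by move=> k; rewrite fine_ge0// hartley_average_ge0.
- by move=> k; rewrite fine_ge0// hartley_average_ge0.
Qed.

End sums_over_boxes.

(** * Integrals over countable partitions *)

Section integrals_over_partitions.
Context d (T : measurableType d) (R : realType) (nu : {measure set T -> \bar R}).

(** The integral over a disjoint union indexed by a countable type is bounded as
    soon as the finite sums of the integrals over the pieces are. *)
Lemma ge0_integral_bigcup_le (I : countType) (E : I -> set T) (G : T -> \bar R) (B : \bar R) :
  (forall i, measurable (E i)) -> trivIset setT E ->
  measurable_fun (\bigcup_i E i) G -> (forall x, (0 <= G x)%E) ->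
  (forall A : seq I, uniq A -> (\sum_(i <- A) \int[nu]_(x in E i) G x <= B)%E) ->
  (\int[nu]_(x in \bigcup_i E i) G x <= B)%E.
Proof.
move=> mE tE mG G0 H.
pose F m := if @pickle_inv I m is Some i then E i else set0.
have FE : \bigcup_i E i = \bigcup_m F m.
  apply/seteqP; split=> x.
    by move=> [i _ Eix]; exists (pickle i) => //; rewrite /F pickleK_inv.
  by move=> [m _]; rewrite /F; case: (pickle_inv m) => // i Eix; exists i.
have mF m : measurable (F m) by rewrite /F; case: pickle_inv.
have tF : trivIset setT F.
  move=> m m' _ _ [x []]; rewrite /F.
  have := @pickle_invK I m; have := @pickle_invK I m'.
  case: (pickle_inv m) => //= i; case: (pickle_inv m') => //= j <- <- Ei Ej.
  by congr pickle; apply: tE => //; exists x.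
rewrite FE ge0_integral_bigcup//; last by rewrite -FE.
apply: lime_le.
  by apply: is_cvg_nneseries => m _ _; apply: integral_ge0.
apply: nearW => N.
rewrite (_ : (\sum_(0 <= i < N) _)%E =
    (\sum_(i <- pmap (@pickle_inv I) (index_iota 0 N)) \int[nu]_(x in E i) G x)%E).
  by apply: H; apply: (pmap_uniq (@pickle_invK I)); exact: iota_uniq.
rewrite big_pmap; apply: eq_bigr => m _; rewrite /F.
by case: pickle_inv => //=; rewrite integral_set0.
Qed.

Lemma sum_le_esum (I : choiceType) (A : seq I) (c : I -> \bar R) : uniq A ->
  (\sum_(i <- A) c i <= \esum_(i in [set: I]) c i)%E.
Proof.
move=> uA; apply: esum_ge; exists [set` A]; first by split.
by rewrite -fsbig_seq.
Qed.

End integrals_over_partitions.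

(** * Dyadic strips and boxes in the half-plane *)

Section strips.
Context {R : realType}.
Notation leb := (@lebesgue_measure R).
Notation mR := (measurableTypeR R).
Notation D := (`]0%R, +oo[%classic : set (measurableTypeR R)).

(** The k-th box of the strip S_n. Its height 2 pi 2 ^ n is larger than its
    width 2 ^ n, and makes the frequencies at its lower edge those of the
    Hartley system at scale 2 ^ n. *)
Definition dyadic_box (n k : int) : set (R * R) :=
  `[2 ^ n, 2 ^ (n + 1)[%classic `*`
  `[2 * pi * 2 ^ n * k%:~R, 2 * pi * 2 ^ n * (k + 1)%:~R[%classic.

Lemma measurable_dyadic_box n k : measurable (dyadic_box n k).
Proof. by apply: measurableX; exact: measurable_itv. Qed.

Lemma measurable_strip n : measurable (strip R n).
Proof.
rewrite (_ : strip R n = `[2 ^ n, 2 ^ (n + 1)[%classic `*` setT).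
  by apply: measurableX => //; exact: measurable_itv.
by apply/seteqP; split=> z; rewrite /strip /= in_itv/=; [move=> ?|case].
Qed.

Lemma exp2_gt0 (n : int) : 0 < 2 ^ n :> R.
Proof. by rewrite exprz_gt0. Qed.

Lemma exp2S (n : int) : 2 ^ (n + 1) = 2 * 2 ^ n :> R.
Proof. by rewrite expfzDr// expr1z mulrC. Qed.

Lemma ex_dyadic (x : R) : 0 < x -> exists n : int, 2 ^ n <= x < 2 ^ (n + 1).
Proof.
move=> x0; pose n := Num.floor (ln x / ln 2).
have l2 : 0 < ln 2 :> R by rewrite ln_gt0// ltr1n.
have E (m : int) : 2 ^ m = expR (m%:~R * ln 2) :> R.
  by rewrite -powR_intmul// /powR gt_eqF.
exists n; rewrite !E -{1 2}(lnK x0) ler_expR ltr_expR.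
rewrite -ler_pdivlMr// -ltr_pdivrMr//.
exact: Num.Theory.floor_itv.
Qed.

Lemma strip_bigcup n : strip R n = \bigcup_k dyadic_box n k.
Proof.
have w0 : 0 < 2 * pi * 2 ^ n :> R by rewrite !mulr_gt0 ?pi_gt0 ?exp2_gt0.
apply/seteqP; split=> z.
  move=> nz; exists (Num.floor (z.2 / (2 * pi * 2 ^ n))) => //; split=> /=.
    by rewrite in_itv.
  rewrite in_itv/= mulrC -ler_pdivlMr// [X in _ < X]mulrC -ltr_pdivrMr//.
  exact: Num.Theory.floor_itv.
by move=> [k _ [] /=]; rewrite in_itv.
Qed.

Lemma trivIset_dyadic_box n : trivIset setT (dyadic_box n).
Proof.
have w0 : 0 < 2 * pi * 2 ^ n :> R by rewrite !mulr_gt0 ?pi_gt0 ?exp2_gt0.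
move=> k j _ _ [z [[_ /=]]]; rewrite !in_itv/= => /andP[k1 k2] [_ /=].
rewrite in_itv/= => /andP[j1 j2].
have := le_lt_trans k1 j2; have := le_lt_trans j1 k2.
rewrite !ltr_pM2l// !ltr_int; lia.
Qed.

Lemma Cplus_bigcup : Cplus R = \bigcup_n strip R n.
Proof.
apply/seteqP; split=> z.
  by move=> /ex_dyadic[n nz]; exists n.
by move=> [n _ /andP[nz _]]; rewrite /Cplus/= (lt_le_trans _ nz)// exp2_gt0.
Qed.

Lemma trivIset_strip : trivIset setT (strip R).
Proof.
have H (n m : int) (x : R) : 2 ^ n <= x -> x < 2 ^ (m + 1) -> (n < m + 1)%R.
  move=> nx xm; rewrite ltNge; apply/negP => mn; have := le_lt_trans nx xm.
  by rewrite ltNge ler_weXz2l// ler1n.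
move=> n m _ _ [z [/andP[n1 n2] /andP[m1 m2]]].
have := H _ _ _ n1 m2; have := H _ _ _ m1 n2; lia.
Qed.

Lemma carleson_const_ge0 (b : R) (nu : set (R * R) -> \bar R) :
  (forall E, 0 <= nu E)%E -> (0 <= carleson_const b nu)%E.
Proof.
move=> nu0.
pose I : set R := `[0, 1]%classic.
apply: (@le_trans _ _ (nu (carleson_box I) * ((fine (interval_length I) `^ b)^-1)%:E)%E).
  by rewrite mule_ge0// lee_fin invr_ge0 powR_ge0.
apply: ereal_sup_ubound; exists I => //; split; first exact: interval_is_interval.
by rewrite /interval_length lebesgue_measure_itv/= lte_fin ltr01 oppr0 adde0 lte_fin ltr01 ltry.
Qed.

(** A Carleson box of side 2 pi 2 ^ n contains every point of its base with
    abscissa below 2 ^ (n + 1), because 2 <= 2 pi. *)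
Lemma measure_dyadic_box_le (mu : {measure set (R * R) -> \bar R}) (q : R) (n k : int) :
  (mu (dyadic_box n k) <=
   ((2 * pi * 2 ^ n) `^ q)%:E * carleson_const q (strip_restr mu n))%E.
Proof.
set w := 2 * pi * 2 ^ n.
have w0 : 0 < w by rewrite !mulr_gt0 ?pi_gt0 ?exp2_gt0.
pose I : set R := `[w * k%:~R, w * (k + 1)%:~R[%classic.
have wk : w * (k + 1)%:~R - w * k%:~R = w by rewrite rmorphD/=; ring.
have lI : interval_length I = w%:E.
  rewrite /interval_length lebesgue_measure_itv/= lte_fin ifT -?EFinB ?wk//.
  by rewrite -subr_gt0 wk.
have H : (strip_restr mu n (carleson_box I) * ((fine (interval_length I) `^ q)^-1)%:E <=
    carleson_const q (strip_restr mu n))%E.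
  apply: ereal_sup_ubound; exists I => //; split; first exact: interval_is_interval.
  by rewrite lI lte_fin w0 ltry.
rewrite lI/= lee_pdivrMr ?powR_gt0// in H.
rewrite muleC; apply: le_trans H; rewrite /strip_restr; apply: le_measure.
- by rewrite inE; exact: measurable_dyadic_box.
- rewrite inE; apply: measurableI; last exact: measurable_strip.
  rewrite (_ : carleson_box I = `]0, w]%classic `*` I).
    by apply: measurableX; exact: measurable_itv.
  by apply/seteqP; split=> z; rewrite /carleson_box/= lI/= in_itv/= => -[].
- move=> z [z1 z2]; split; last by move: z1; rewrite /strip/= in_itv.
  split=> //; rewrite lI/=; move: z1; rewrite /= in_itv/= => /andP[z1 z1'].
  rewrite (lt_le_trans _ z1) ?exp2_gt0//= (le_trans (ltW z1'))// exp2S /w.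
  by rewrite ler_pM2r ?exp2_gt0//; have := pi_ge2 R; lra.
Qed.

Lemma box_bound_ge0 (f : R -> R[i]) (a : R) k : 0 < a -> 0 <= box_bound f a k.
Proof.
move=> a0; apply: mulr_ge0 => //; apply: addr_ge0; apply: addr_ge0;
  by apply: fine_ge0; exact: hartley_average_ge0.
Qed.

Definition strip_const (q : R) : R := box_const q * (2 * pi) `^ q.

(** The strip estimate. As P is real and possibly 0, the bound is meaningful, and
    equal to 0, also when P = 0 and the Carleson constant is infinite. *)
Lemma integral_strip_le (q P : R) (n : int) (mu : {measure set (R * R) -> \bar R}) (f : R -> R[i]) :
  2 <= q -> 0 <= P -> cmeasurable_fun (`]0%R, +oo[%classic : set R) f ->
  (\int[leb]_(t in D) (expR (- (q / (q - 1) * (2 ^ n / 2) * t)) *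
     Normc.normc (f t) `^ (q / (q - 1)))%:E <= P%:E)%E ->
  (\int[mu]_(z in strip R n) (Normc.normc (laplace f z) `^ q)%:E <=
   (strip_const q * (2 ^ n * P) `^ (q - 1))%:E * carleson_const q (strip_restr mu n))%E.
Proof.
move=> q2 P0 mf fP; set C := carleson_const _ _; set a : R := 2 ^ n in fP *.
have a0 : 0 < a by exact: exp2_gt0.
have [hu hv S] := sum_box_bound q2 a0 P0 mf fP.
have C0 : (0 <= C)%E by apply: carleson_const_ge0 => E; exact: measure_ge0.
have uf t : 0 < t -> `|Re_part f t| <= Normc.normc (f t).
  by move=> t0; rewrite Re_partE// Re_le_normc.
have vf t : 0 < t -> `|Im_part f t| <= Normc.normc (f t).
  by move=> t0; rewrite Im_partE// Im_le_normc.
have ufin := integral_damp_lty q2 a0 mf fP (measurable_Re_part mf) uf.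
have vfin := integral_damp_lty q2 a0 mf fP (measurable_Im_part mf) vf.
have mG (E : set (R * R)) : measurable_fun E (fun z => Normc.normc (laplace f z) `^ q).
  apply: (measurableT_comp (measurable_powR _)).
  by apply: measurable_normc; exact: cmeasurable_laplace.
rewrite strip_bigcup; apply: ge0_integral_bigcup_le.
- by move=> k; exact: measurable_dyadic_box.
- exact: trivIset_dyadic_box.
- exact/measurable_EFinP.
- by move=> z; rewrite lee_fin powR_ge0.
move=> A uA.
have w0 : 0 < 2 * pi * a by rewrite !mulr_gt0 ?pi_gt0.
apply: (@le_trans _ _ (\sum_(k <- A) (box_bound f a k `^ q)%:E * (((2 * pi * a) `^ q)%:E * C))%E).
  apply: lee_sum => k _.
  apply: (@le_trans _ _ ((box_bound f a k `^ q)%:E * mu (dyadic_box n k))%E); last first.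
    by apply: lee_wpmul2l; rewrite ?lee_fin ?powR_ge0//; exact: measure_dyadic_box_le.
  rewrite -integral_cst; last exact: measurable_dyadic_box.
  apply: ge0_le_integral => //.
  - exact: measurable_dyadic_box.
  - by move=> z _; rewrite lee_fin powR_ge0.
  - exact/measurable_EFinP.
  move=> z [/= z1 z2]; move: z1 z2; rewrite !in_itv/= => /andP[z1 z1'] /andP[z2 z2'].
  rewrite lee_fin; apply: ge0_ler_powR; rewrite ?nnegrE ?normc_ge0 ?box_bound_ge0//; first lra.
  by apply: laplace_le_box_bound => //; rewrite -exp2S.
rewrite -ge0_sume_distrl; last by move=> k _; rewrite lee_fin powR_ge0.
rewrite sumEFin muleA -EFinM; apply: lee_wpmul2r => //; rewrite lee_fin.
apply: (@le_trans _ _ (box_const q / a * P `^ (q - 1) * (2 * pi * a) `^ q)).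
  by rewrite ler_wpM2r ?powR_ge0//; exact: S.
have qE : a `^ q = a * a `^ (q - 1) by rewrite mulr_powRB1 ?(ltW a0)//; lra.
have pi20 : 0 <= 2 * pi :> R by rewrite mulr_ge0// pi_ge0.
rewrite (@powRM _ (2 * pi)) ?(ltW a0)// qE (@powRM _ a P) ?(ltW a0)// /strip_const.
by rewrite le_eqVlt; apply/orP; left; apply/eqP; field; exact: lt0r_neq0.
Qed.

End strips.

(** * Young's inequality *)

Section young.
Context {R : realType}.
Notation leb := (@lebesgue_measure R).
Notation mR := (measurableTypeR R).
Notation D := (`]0%R, +oo[%classic : set (measurableTypeR R)).

(** Monotonicity on [0, +oo[; the values at negative arguments are irrelevant. *)
Definition nondecreasing_from0 (phi : R -> \bar R) : Prop :=
  forall s t, 0 <= s -> s <= t -> (phi s <= phi t)%E.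

Lemma measurable_nondecreasing_from0 (phi : R -> \bar R) : nondecreasing_from0 phi ->
  @measurable_fun _ _ mR _ `[0, +oo[%classic phi.
Proof.
move=> ndphi mD; apply: (measurability _ (ErealGenOInfty.measurableE R)) => //.
move=> /= _ [_ [r ->]] <-; apply: is_interval_measurable => x y [/=].
rewrite !in_itv/= !andbT => x0 rx [y0 ry] z /andP[xz zy].
have z0 : 0 <= z by exact: le_trans xz.
by split; rewrite /= in_itv/= andbT//; apply: (lt_le_trans rx); exact: ndphi.
Qed.

Lemma measurable_comp_nondecreasing_from0 d (T : measurableType d) (E : set T)
    (phi : R -> \bar R) (h : T -> R) : measurable E -> nondecreasing_from0 phi ->
  (forall x, E x -> 0 <= h x) -> measurable_fun E h ->
  measurable_fun E (fun x => phi (h x)).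
Proof.
move=> mE ndphi h0 mh.
apply: (measurable_comp (F := `[0, +oo[%classic : set mR)) => //.
- by move=> _ [x Ex <-]; rewrite /= in_itv/= andbT h0.
- exact: measurable_nondecreasing_from0.
Qed.

Lemma nondecreasing_integral_from0 (phi : R -> \bar R) : nondecreasing_from0 phi ->
  (forall t, 0 <= t -> (0 <= phi t)%E) -> nondecreasing_from0 (integral_from0 phi).
Proof.
move=> ndphi phi0 s t s0 st; rewrite /integral_from0.
apply: ge0_subset_integral => //.
- apply: measurable_funS (measurable_nondecreasing_from0 ndphi); first exact: measurable_itv.
  by move=> x; rewrite /= !in_itv/= andbT => /andP[].
- by move=> x; rewrite /= in_itv/= => /andP[x0 _]; exact: phi0.
- by move=> x; rewrite /= !in_itv/= => /andP[-> /le_trans]; exact.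
Qed.

Lemma generalized_inverse_ge0 (phi : R -> \bar R) s : (0 <= generalized_inverse phi s)%E.
Proof. by apply/ereal_infP => _ [t [t0 _] <-]; rewrite lee_fin. Qed.

Lemma nondecreasing_generalized_inverse (phi : R -> \bar R) :
  nondecreasing_from0 (generalized_inverse phi).
Proof.
move=> s t _ st; apply/ereal_infP => _ [u [u0 tu] <-]; apply: ereal_inf_lbound.
exists u => //; split=> //.
by apply: le_trans tu; rewrite lee_fin.
Qed.

(** The graph of the density phi cuts the rectangle [0, s] x [0, t] into a part
    below it, of area at most Phi s, and a part above it. By Tonelli's theorem the
    latter has area at most Phi^c t, since its horizontal sections are bounded by
    the generalized inverse of phi. *)
Lemma young_inequality (Phi : young_function R) (s t : R) : 0 <= s -> 0 <= t ->
  ((s * t)%:E <= Phi s + complementary Phi t)%E.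
Proof.
move=> s0 t0; set phi := young_density Phi; set psi := generalized_inverse phi.
have ndphi : nondecreasing_from0 phi by exact: young_nondecreasing.
have phi0 : forall u, 0 <= u -> (0 <= phi u)%E by exact: young_ge0.
have ndpsi : nondecreasing_from0 psi by exact: nondecreasing_generalized_inverse.
pose f (z : mR * mR) : R :=
  if (0 <= z.1) && (z.1 <= s) && ((0 <= z.2) && (z.2 <= t)) then
    (if (z.2%:E <= phi (Num.max z.1 0)%R)%E then 0 else 1) else 0.
have m1 : measurable_fun setT (fun z : mR * mR => z.1) by exact: measurable_fst.
have m2 : measurable_fun setT (fun z : mR * mR => z.2) by exact: measurable_snd.
have mphi : measurable_fun setT (fun z : mR * mR => phi (Num.max z.1 0)).
  apply: measurable_comp_nondecreasing_from0 => //; first by move=> x _; rewrite le_max lexx orbT.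
  exact: measurable_maxr.
have mf : measurable_fun setT f.
  apply: measurable_fun_ifT => //.
  - by apply: measurable_and; apply: measurable_and; exact: measurable_fun_ler.
  - apply: measurable_fun_ifT => //.
    by apply: measurable_fun_lee => //; exact/measurable_EFinP.
have mEf : measurable_fun setT (fun z => (f z)%:E) by exact/measurable_EFinP.
have f0 z : (0 <= (f z)%:E)%E by rewrite lee_fin /f; case: ifP => // _; case: ifP.
(* f is the indicator of the points of the rectangle with phi u < v. *)
have fE u v : f (u, v) = if (0 <= u) && (u <= s) && ((0 <= v) && (v <= t)) then
    (if (v%:E <= phi (Num.max u 0)%R)%E then 0 else 1) else 0 by [].
clear mf; clearbody f.
have tonelli := fubini_tonelli (m1 := leb) (m2 := leb) (fun z => (f z)%:E)
  mEf f0.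
have ms : measurable (`[0, s]%classic : set mR) by exact: measurable_itv.
have mt : measurable (`[0, t]%classic : set mR) by exact: measurable_itv.
have sub r : (`[0, r]%classic : set mR) `<=` `[0, +oo[%classic.
  by move=> x; rewrite /= !in_itv/= andbT => /andP[].
have mphis : measurable_fun (`[0, s]%classic : set mR) phi.
  apply: measurable_funS (measurable_nondecreasing_from0 ndphi) => //; exact: measurable_itv.
have mpsit : measurable_fun (`[0, t]%classic : set mR) psi.
  apply: measurable_funS (measurable_nondecreasing_from0 ndpsi) => //; exact: measurable_itv.
have lens (r : R) : 0 <= r -> leb (`[0%R, r]%classic : set mR) = r%:E.
  rewrite le_eqVlt => /predU1P[<-|r0]; rewrite lebesgue_measure_itv/= ?lte_fin ?ltxx//.
  by rewrite r0 oppr0 adde0.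
(* For each u, the part of [0, t] below phi u has measure at most phi u. *)
have lower u : `[0, s]%classic u -> (t%:E <= phi u + \int[leb]_v (f (u, v))%:E)%E.
  rewrite /= in_itv/= => /andP[u0 us].
  have F0 : (0 <= \int[leb]_v (f (u, v))%:E)%E.
    by apply: integral_ge0 => v _; exact: (f0 (u, v)).
  case: (leP t%:E (phi u)) => [tu|ut]; first by rewrite (le_trans tu)// leeDl.
  move: ut (phi0 u u0); case phiu : (phi u) => [r| |//]; rewrite ?lte_fin ?lee_fin => rt r0 //.
  have len : leb (`]r, t]%classic : set mR) = (t - r)%:E.
    by rewrite lebesgue_measure_itv/= lte_fin rt -EFinB.
  have -> : (\int[leb]_v (f (u, v))%:E = (t - r)%:E)%E.
    rewrite -len -[RHS]mul1e -integral_cst; last exact: measurable_itv.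
    rewrite [RHS]integral_mkcond; apply: eq_integral => v _.
    rewrite patchE mem_setE in_itv/= fE/= u0 us/= (max_l u0) phiu lee_fin (leNgt v r).
    have [rv|vr] := ltP r v; last by case: ifP.
    by rewrite (ltW (le_lt_trans r0 rv))/=; case: ifP.
  by rewrite -EFinD lee_fin addrC subrK.
(* For each v, the points u of [0, s] with phi u < v lie below psi v. *)
have upper v : (\int[leb]_u (f (u, v))%:E <= if (0 <= v <= t)%R then psi v else 0)%E.
  case: ifPn => vt; last first.
    by rewrite integral0_eq// => u _; rewrite fE/= (negbTE vt) andbF.
  have := generalized_inverse_ge0 phi v; rewrite -/psi.
  case psiv : (psi v) => [r| |//]; rewrite ?leey// lee_fin => r0.
  rewrite -(lens r r0) -[leRHS]mul1e -integral_cst//.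
  have mfv : measurable_fun (setT : set mR) (fun u : mR => (f (u, v))%:E).
    apply: (measurableT_comp mEf).
    exact: (measurable_fun_pair (@measurable_id _ mR setT) (measurable_cst v)).
  have mr : measurable (`[0, r]%classic : set mR) by exact: measurable_itv.
  rewrite [leRHS]integral_mkcond.
  apply: (ge0_le_integral leb measurableT (fun u _ => f0 (u, v)) mfv).
    by apply/(measurable_restrictT _ mr); exact: measurable_cst.
  have c0 (b : bool) : (0%:E <= if b then 1%E else 0 :> \bar R)%E by case: b.
  move=> u _; rewrite patchE mem_setE in_itv/= fE vt andbT.
  have [/andP[u0 us]|_] := boolP (0 <= u <= s); last exact: c0.
  rewrite (max_l u0) u0/=; case: (leP v%:E (phi u)) => [_|ut]; first exact: c0.
  rewrite ifT ?lexx// -lee_fin -psiv; apply/ereal_infP => _ [w [w0 vw] <-].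
  rewrite lee_fin leNgt; apply/negP => wu.
  by have := lt_le_trans (le_lt_trans (ndphi _ _ w0 (ltW wu)) ut) vw; rewrite ltxx.
have mF : measurable_fun setT (fun u => \int[leb]_v (f (u, v))%:E)%E.
  exact: (measurable_fun_fubini_tonelli_F (m2 := leb) (fun z => (f z)%:E) mEf f0).
have mG : measurable_fun setT (fun v => \int[leb]_u (f (u, v))%:E)%E.
  exact: (measurable_fun_fubini_tonelli_G (m1 := leb) (fun z => (f z)%:E) mEf f0).
have F0 u : (0 <= \int[leb]_v (f (u, v))%:E)%E.
  by apply: integral_ge0 => v _; exact: (f0 (u, v)).
have G0 v : (0 <= \int[leb]_u (f (u, v))%:E)%E.
  by apply: integral_ge0 => u _; exact: (f0 (u, v)).
have -> : (s * t)%:E = (\int[leb]_(u in `[0%R, s]) (cst t%:E u))%E.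
  rewrite (integral_cst leb ms) mulrC EFinM; congr (_ * _)%E.
  by rewrite -(lens s s0).
apply: (@le_trans _ _ (\int[leb]_(u in `[0%R, s]) (phi u + \int[leb]_v (f (u, v))%:E))%E).
  apply: ge0_le_integral => //; by apply: emeasurable_funD => //; exact: measurable_funTS.
rewrite ge0_integralD//; last 2 first.
- by move=> u; rewrite /= in_itv/= => /andP[u0 _]; exact: phi0.
- exact: measurable_funTS.
apply: leeD => //.
apply: (@le_trans _ _ (\int[leb]_u \int[leb]_v (f (u, v))%:E)%E).
  by apply: ge0_subset_integral.
rewrite tonelli /complementary /integral_from0 [leRHS]integral_mkcond.
apply: ge0_le_integral => //.
- by apply/(measurable_restrictT _ mt).
move=> v _; apply: (le_trans (upper v)).
by rewrite patchE mem_setE in_itv.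
Qed.

End young.

(** * Orlicz spaces and Hoelder's inequality *)

Section orlicz.
Context {R : realType}.
Notation leb := (@lebesgue_measure R).
Notation mR := (measurableTypeR R).
Notation D := (`]0%R, +oo[%classic : set (measurableTypeR R)).
Variable Phi : young_function R.

Lemma young_eval_ge0 t : (0 <= Phi t)%E.
Proof.
by apply: integral_ge0 => s; rewrite /= in_itv/= => /andP[s0 _]; exact: young_ge0.
Qed.

Lemma complementary_ge0 t : (0 <= complementary Phi t)%E.
Proof. by apply: integral_ge0 => s _; exact: generalized_inverse_ge0. Qed.

Lemma nondecreasing_young_eval : nondecreasing_from0 Phi.
Proof.
apply: nondecreasing_integral_from0; first exact: young_nondecreasing.
exact: young_ge0.
Qed.

Lemma nondecreasing_complementary : nondecreasing_from0 (complementary Phi).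
Proof.
apply: nondecreasing_integral_from0; first exact: nondecreasing_generalized_inverse.
by move=> t _; exact: generalized_inverse_ge0.
Qed.

(** Hoelder's inequality before normalization of h: only e has been scaled into
    the unit ball of the complementary space. *)
Lemma orlicz_hoelder (e h : R -> R) (k l : R) : 0 < k -> 0 < l ->
  measurable_fun D e -> measurable_fun D h ->
  (forall t, D t -> 0 <= e t) -> (forall t, D t -> 0 <= h t) ->
  (\int[leb]_(t in D) (complementary Phi (k^-1 * e t)) <= 1)%E ->
  (\int[leb]_(t in D) (e t * h t)%:E <=
     (k * l)%:E * (1 + \int[leb]_(t in D) Phi (l^-1 * h t)%R))%E.
Proof.
move=> k0 l0 me mh e0 h0 ke; have mD : measurable D by exact: measurable_itv.
have ek t : D t -> 0 <= k^-1 * e t by move=> Dt; rewrite mulr_ge0 ?invr_ge0 ?e0// ltW.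
have hl t : D t -> 0 <= l^-1 * h t by move=> Dt; rewrite mulr_ge0 ?invr_ge0 ?h0// ltW.
have mek : measurable_fun D (fun t => k^-1 * e t) by exact: measurable_funM.
have mhl : measurable_fun D (fun t => l^-1 * h t) by exact: measurable_funM.
have mC := measurable_comp_nondecreasing_from0 mD nondecreasing_complementary ek mek.
have mP := measurable_comp_nondecreasing_from0 mD nondecreasing_young_eval hl mhl.
have kl0 : 0 < k * l by rewrite mulr_gt0.
apply: (@le_trans _ _ (\int[leb]_(t in D) ((k * l)%:E *
    (complementary Phi (k^-1 * e t)%R + Phi (l^-1 * h t)%R)))%E).
  apply: (ge0_le_integral leb mD).
  - by move=> t Dt; rewrite lee_fin mulr_ge0 ?e0 ?h0.
  - by apply/measurable_EFinP; exact: measurable_funM.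
  - by apply: emeasurable_funM; [exact: measurable_cst|exact: emeasurable_funD].
  move=> t Dt; have := young_inequality Phi (hl t Dt) (ek t Dt).
  rewrite addeC => H; have := lee_wpmul2l (ltW (kl0 : (0 < (k * l)%:E)%E)) H.
  apply: le_trans; rewrite -EFinM lee_fin le_eqVlt; apply/orP; left; apply/eqP.
  by field; rewrite !lt0r_neq0.
have mCP := emeasurable_funD mC mP.
rewrite ge0_integralZl_EFin//; last 2 first.
- by move=> t _; rewrite adde_ge0 ?complementary_ge0 ?young_eval_ge0.
- exact: ltW.
apply: lee_wpmul2l; first by rewrite lee_fin ltW.
rewrite ge0_integralD//.
- exact: leeD2r.
- by move=> t _; exact: complementary_ge0.
- by move=> t _; exact: young_eval_ge0.
Qed.

(** The complementary function is finite and at most linear near 0, because the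
    density of Phi does not vanish identically. *)
Lemma complementary_lin : exists m t0 : R, [/\ 0 < m, 0 <= t0 &
  forall x, 0 <= x -> x <= m -> (complementary Phi x <= (t0 * x)%:E)%E].
Proof.
have [t0 t00 phi0] := young_neq0 Phi.
have pos : (0 < young_density Phi t0)%E by rewrite lt0e young_ge0// andbT; apply/eqP.
have [m m0 mphi] : exists2 m : R, 0 < m & (m%:E <= young_density Phi t0)%E.
  case: (young_density Phi t0) pos => [r| |//]; first by rewrite lte_fin => r0; exists r.
  by move=> _; exists 1; rewrite ?leey.
exists m, t0; split=> // x x0 xm; rewrite /complementary /integral_from0.
have mx : measurable (`[0, x]%classic : set mR) by exact: measurable_itv.
apply: (@le_trans _ _ (\int[leb]_(v in `[0%R, x]) cst t0%:E v)%E).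
  apply: (ge0_le_integral leb mx).
  - by move=> v _; exact: generalized_inverse_ge0.
  - apply: measurable_funS (measurable_nondecreasing_from0 (@nondecreasing_generalized_inverse _ _)).
      exact: measurable_itv.
    by move=> v; rewrite /= !in_itv/= andbT => /andP[].
  - exact: measurable_cst.
  move=> v; rewrite /= in_itv/= => /andP[v0 vx]; apply: ereal_inf_lbound.
  exists t0 => //; split=> //; apply: le_trans mphi.
  by rewrite lee_fin (le_trans vx).
have len : (leb (`[0%R, x]%classic : set mR) <= x%:E)%E.
  rewrite lebesgue_measure_itv/= lte_fin; case: ifP => _; last by rewrite lee_fin.
  by rewrite oppr0 adde0.
by rewrite (integral_cst leb mx) EFinM; apply: lee_wpmul2l; rewrite ?lee_fin.
Qed.

(** Exponentials belong to the complementary Orlicz space. *)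
Lemma ex_orlicz_exp (c : R) : 0 < c -> exists2 k : R, 0 < k &
  (\int[leb]_(t in D) complementary Phi (k^-1 * expR (- (c * t)))%R <= 1)%E.
Proof.
move=> c0; have [m [t0 [m0 t00 H]]] := complementary_lin.
have mD : measurable D by exact: measurable_itv.
(* The first term keeps the argument below m, the second makes the integral of
   the linear bound at most 1. *)
pose k := m^-1 + t0 / c.
have k0 : 0 < k by rewrite /k ltr_pwDl ?invr_gt0 ?divr_ge0// ltW.
have km : k^-1 <= m.
  by rewrite -[m]invrK lef_pV2 ?posrE ?invr_gt0// /k lerDl divr_ge0// ltW.
exists k => //.
apply: (@le_trans _ _ (\int[leb]_(t in D) (t0 / k * expR (- (c * t)))%:E)%E).
  apply: (ge0_le_integral leb mD).
  - by move=> t _; exact: complementary_ge0.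
  - apply: (measurable_comp_nondecreasing_from0 mD nondecreasing_complementary).
      by move=> t _; rewrite mulr_ge0 ?expR_ge0 ?invr_ge0// ltW.
    by apply: measurable_funM => //; exact: measurable_expRN.
  - by apply/measurable_EFinP/measurable_funM => //; exact: measurable_expRN.
  move=> t; rewrite /= in_itv/= andbT => tpos.
  have ct : 0 <= c * t by rewrite mulr_ge0// ltW.
  have e1 : expR (- (c * t)) <= 1 by rewrite -expR0 ler_expR oppr_le0.
  rewrite -mulrA; apply: H.
    by rewrite mulr_ge0 ?expR_ge0 ?invr_ge0// ltW.
  by apply: le_trans km; rewrite ler_piMr// invr_ge0 ltW.
rewrite ge0_integralZlR//; last 2 first.
- exact: measurable_expRN.
- by rewrite divr_ge0// ltW.
rewrite integral_expRN0// -EFinM lee_fin -mulrA -invfM ler_pdivrMr ?mulr_gt0// mul1r.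
rewrite /k mulrDl divfK ?lt0r_neq0// lerDr; apply: mulr_ge0; last exact: ltW.
by rewrite invr_ge0 ltW.
Qed.

End orlicz.

Section orlicz_norm.
Context {R : realType}.

Lemma orlicz_norm_ge0 (Phi : R -> \bar R) J f : (0 <= orlicz_norm Phi J f)%E.
Proof. by apply/ereal_infP => _ [k [k0 _] <-]; rewrite lee_fin ltW. Qed.

(** If X <= k c for every k admissible in the definition of the norm, then X is at
    most c times the norm; one admissible k makes the norm finite. *)
Lemma orlicz_norm_le (Phi : R -> \bar R) J f (X c : R) : 0 <= c ->
  (exists k, 0 < k /\ (\int[@lebesgue_measure R]_(s in J) Phi (k^-1 * Normc.normc (f s))%R <= 1)%E) ->
  (forall k, 0 < k ->
    (\int[@lebesgue_measure R]_(s in J) Phi (k^-1 * Normc.normc (f s))%R <= 1)%E -> X <= k * c) ->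
  orlicz_norm Phi J f \is a fin_num /\ X <= fine (orlicz_norm Phi J f) * c.
Proof.
move=> c0 [k1 [k10 k1P]] H.
have fin : orlicz_norm Phi J f \is a fin_num.
  rewrite ge0_fin_numE ?orlicz_norm_ge0//; apply: (@le_lt_trans _ _ k1%:E); last exact: ltry.
  by apply: ereal_inf_lbound; exists k1.
split=> //; move: c0; rewrite le_eqVlt => /predU1P[c0|c0].
  by rewrite -c0 mulr0; have := H _ k10 k1P; rewrite -c0 mulr0.
rewrite -ler_pdivrMr// -lee_fin fineK//; apply/ereal_infP => _ [k [k0 kP] <-].
by rewrite lee_fin ler_pdivrMr//; exact: H.
Qed.

End orlicz_norm.

(** * The norm of the Laplace transform *)

Lemma strip_const_gt0 {R : realType} (q : R) : 2 <= q -> 0 < strip_const q.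
Proof.
move=> q2; have hc := hartley_const_gt0 q2.
have pi20 : 0 < 2 * pi :> R by apply: mulr_gt0 => //; exact: pi_gt0.
apply: mulr_gt0 (powR_gt0 _ pi20); apply: mulr_gt0 hc.
by apply: mulr_gt0; [exact: powR_gt0|].
Qed.

Section assembly.
Context {R : realType}.
Notation leb := (@lebesgue_measure R).
Notation mR := (measurableTypeR R).
Notation D := (`]0%R, +oo[%classic : set (measurableTypeR R)).
Variables (q : R) (Phi Phit : young_function R) (mu : {measure set (R * R) -> \bar R}).
Hypothesis q2 : 2 <= q.
Let p := q / (q - 1).
Hypothesis PhiE : forall t : R, 0 <= t -> Phi t = Phit (t `^ p).

Let N n := orlicz_norm (complementary Phit) `]0%R, +oo[ (exp_dyadic p n).
Let C n := carleson_const q (strip_restr mu n).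
Let term n := (((2 ^ n)%:E * N n) `^ (q - 1) * C n)%E.

Lemma normc_exp_dyadic n t :
  Normc.normc (exp_dyadic p n t) = expR (- (p * (2 ^ n / 2) * t)).
Proof.
rewrite /exp_dyadic /= expr0n addr0 sqrtr_sqr ger0_norm ?expR_ge0//.
by rewrite expfzDr// exprN1.
Qed.

Section fixed_function.
Variables (f : R -> R[i]) (k c : R).
Hypotheses (mf : cmeasurable_fun (`]0%R, +oo[%classic : set R) f) (k0 : 0 < k) (c0 : 0 <= c).
Hypothesis fc : (\int[leb]_(t in D) Phi (k^-1 * Normc.normc (f t))%R <= c%:E)%E.

(** The p-th moment of f with the weight e_n, controlled by the norm of e_n; here
    Phi (|f| / k) = Phit (|f|^p / k^p). *)
Lemma exp_moment_le n : N n \is a fin_num /\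
  (\int[leb]_(t in D) (expR (- (p * (2 ^ n / 2) * t)) * Normc.normc (f t) `^ p)%:E
    <= (fine (N n) * (k `^ p * (1 + c)))%:E)%E.
Proof.
have hq := q2.
have p0 : 0 < p by rewrite /p divr_gt0//; lra.
have rate0 : 0 < p * (2 ^ n / 2) by rewrite mulr_gt0// divr_gt0// exp2_gt0.
have kp0 : 0 < k `^ p by rewrite powR_gt0.
have mD : measurable D by exact: measurable_itv.
have mh : measurable_fun D (fun t => Normc.normc (f t) `^ p).
  by apply: (measurableT_comp (measurable_powR _)); exact: (measurable_normc mf).
set X := (\int[leb]_(t in D) _)%E.
have X0 : (0 <= X)%E.
  by apply: integral_ge0 => t _; rewrite lee_fin mulr_ge0 ?expR_ge0 ?powR_ge0.
have intPhi : (\int[leb]_(t in D) Phit ((k `^ p)^-1 * Normc.normc (f t) `^ p)%R <= c%:E)%E.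
  apply: le_trans fc; rewrite le_eqVlt; apply/orP; left; apply/eqP.
  apply: eq_integral => t _; have w0 := normc_ge0 (f t).
  have -> : (k `^ p)^-1 * Normc.normc (f t) `^ p = (k^-1 * Normc.normc (f t)) `^ p.
    rewrite [RHS]powRM ?invr_ge0 ?(ltW k0)//; congr (_ * _).
    by rewrite -powR_inv1 ?powR_ge0// -powRrM mulrC powRrM powR_inv1 ?(ltW k0).
  by symmetry; apply: PhiE; rewrite mulr_ge0// invr_ge0 ltW.
have H j : 0 < j ->
    (\int[leb]_(t in D) complementary Phit (j^-1 * expR (- (p * (2 ^ n / 2) * t)))%R <= 1)%E ->
    (X <= (j * (k `^ p * (1 + c)))%:E)%E.
  move=> j0 jH.
  apply: (le_trans (orlicz_hoelder (Phi := Phit) (h := fun t => Normc.normc (f t) `^ p)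
    j0 kp0 _ mh _ _ jH)).
  - exact: measurable_expRN.
  - by move=> t _; exact: expR_ge0.
  - by move=> t _; exact: powR_ge0.
  rewrite mulrA [leRHS]EFinM; apply: lee_wpmul2l.
    by rewrite lee_fin ltW// mulr_gt0.
  by rewrite EFinD; exact: leeD2l.
have [j j0 jH] := ex_orlicz_exp Phit rate0.
have Xfin : X \is a fin_num by rewrite ge0_fin_numE// (le_lt_trans (H j j0 jH))// ltry.
have E i : (\int[leb]_(s in `]0%R, +oo[) complementary Phit
      (i^-1 * Normc.normc (exp_dyadic p n s))%R)%E =
    (\int[leb]_(t in D) complementary Phit (i^-1 * expR (- (p * (2 ^ n / 2) * t)))%R)%E.
  by apply: eq_integral => t _; rewrite normc_exp_dyadic.
rewrite -(fineK Xfin) lee_fin; apply: orlicz_norm_le.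
- by rewrite mulr_ge0 ?powR_ge0// addr_ge0.
- by exists j; split; [exact: j0|rewrite E; exact: jH].
- by move=> i i0; rewrite E => iH; rewrite -lee_fin fineK//; exact: H.
Qed.

Let P n := fine (N n) * (k `^ p * (1 + c)).

Let P0 n : 0 <= P n.
Proof.
rewrite /P mulr_ge0 ?fine_ge0 ?orlicz_norm_ge0// mulr_ge0 ?powR_ge0//.
by rewrite addr_ge0.
Qed.

Lemma cintegrable_laplace z : Cplus R z -> cintegrable `]0, +oo[ (laplace_kernel f z).
Proof.
move=> /ex_dyadic[n /andP[nz _]].
have a0 : 0 < 2 ^ n :> R by exact: exp2_gt0.
have [_ fP] := exp_moment_le n.
apply: (cintegrable_laplace_kernel mf _ _ nz).
- apply: (integral_damp_lty q2 a0 mf fP (measurable_Re_part mf)).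
  by move=> t t0; rewrite Re_partE// Re_le_normc.
- apply: (integral_damp_lty q2 a0 mf fP (measurable_Im_part mf)).
  by move=> t t0; rewrite Im_partE// Im_le_normc.
Qed.

(** The bound in L^q(mu), for f whose modular at level k is at most c. It is used
    with c = 1 for the norm inequality, and with an arbitrary c to see that the
    Laplace transform of every f in the Orlicz space belongs to L^q(mu). *)
Lemma integral_laplace_le :
  (\int[mu]_(z in Cplus R) (Normc.normc (laplace f z) `^ q)%:E <=
    (strip_const q * (1 + c) `^ (q - 1) * k `^ q)%:E * \esum_(n in [set: int]) term n)%E.
Proof.
have hq := q2.
set W := strip_const q * (1 + c) `^ (q - 1) * k `^ q.
have W0 : 0 <= W.
  by rewrite /W mulr_ge0 ?powR_ge0// mulr_ge0 ?powR_ge0// ltW// strip_const_gt0.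
have C0 n : (0 <= C n)%E by apply: carleson_const_ge0 => E; exact: measure_ge0.
rewrite Cplus_bigcup; apply: ge0_integral_bigcup_le.
- by move=> n; exact: measurable_strip.
- exact: trivIset_strip.
- apply/measurable_EFinP; apply: (measurableT_comp (measurable_powR _)).
  by apply: measurable_normc; exact: cmeasurable_laplace.
- by move=> z; rewrite lee_fin powR_ge0.
move=> A uA; apply: (@le_trans _ _ (\sum_(n <- A) W%:E * term n)%E); last first.
  rewrite -ge0_sume_distrr; last by move=> n _; rewrite mule_ge0 ?poweR_ge0.
  by apply: lee_wpmul2l; rewrite ?lee_fin//; exact: sum_le_esum.
apply: lee_sum => n _; have [Nfin fP] := exp_moment_le n.
apply: (le_trans (integral_strip_le mu q2 (P0 n) mf fP)).
rewrite /term -/(C n) -{1}(fineK Nfin) -EFinM poweR_EFin muleA -EFinM.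
apply: lee_wpmul2r => //; rewrite lee_fin le_eqVlt; apply/orP; left; apply/eqP.
have N0 : 0 <= fine (N n) by rewrite fine_ge0// orlicz_norm_ge0.
have twon : 0 <= 2 ^ n :> R by rewrite ltW// exp2_gt0.
have c10 : 0 <= 1 + c by rewrite addr_ge0.
have -> : (2 ^ n * P n) `^ (q - 1) =
    (2 ^ n * fine (N n)) `^ (q - 1) * ((k `^ p) `^ (q - 1) * (1 + c) `^ (q - 1)).
  rewrite -[in RHS](powRM _ (powR_ge0 k p) c10) -powRM ?mulr_ge0 ?powR_ge0//.
  by congr (_ `^ _); rewrite /P -mulrA.
have -> : (k `^ p) `^ (q - 1) = k `^ q.
  by rewrite -powRrM; congr (_ `^ _); rewrite /p; field; lra.
by rewrite /W; ring.
Qed.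

End fixed_function.

(** If the sum on the right is a real number s, then M = (K s)^(1/q) is an
    admissible bound for the operator. *)
Lemma laplace_opnorm_le :
  (laplace_opnorm Phi q mu `^ q <=
    (strip_const q * 2 `^ (q - 1))%:E * \esum_(n in [set: int]) term n)%E.
Proof.
have hq := q2; have q0 : 0 < q by lra.
set K := strip_const q * 2 `^ (q - 1).
have K0 : 0 < K by rewrite mulr_gt0 ?strip_const_gt0 ?powR_gt0.
have C0 n : (0 <= C n)%E by apply: carleson_const_ge0 => E; exact: measure_ge0.
have S0 : (0 <= \esum_(n in [set: int]) term n)%E.
  by apply: esum_ge0 => n _; rewrite mule_ge0 ?poweR_ge0.
case SE : (\esum_(n in [set: int]) term n)%E S0 => [s| |//] S0; last first.
  by rewrite gt0_muley ?lte_fin// leey.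
rewrite lee_fin in S0.
pose M := (K * s) `^ q^-1.
have Ks0 : 0 <= K * s by rewrite mulr_ge0// ltW.
have M0 : 0 <= M by exact: powR_ge0.
have Mq : M `^ q = K * s by rewrite /M -powRrM mulVf ?lt0r_neq0// powRr1.
suff HM : (laplace_opnorm Phi q mu <= M%:E)%E.
  have op0 : (0 <= laplace_opnorm Phi q mu)%E.
    by apply/ereal_infP => _ [m [m0 _] <-]; rewrite lee_fin.
  rewrite -EFinM -Mq -poweR_EFin; apply: gt0_ler_poweR => //.
  - exact: ltW.
  - by rewrite in_itv/= op0 leey.
  - by rewrite in_itv/= lee_fin M0 leey.
apply: ereal_inf_lbound; exists M => //; split=> // f [mf [k k0 ik]].
have Phi0 t : (0 <= Phi t)%E by exact: young_eval_ge0.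
have fin : (\int[leb]_(t in D) Phi (k^-1 * Normc.normc (f t))%R)%E \is a fin_num.
  exact: integrable_fin_num.
pose c := fine (\int[leb]_(t in D) Phi (k^-1 * Normc.normc (f t))%R)%E.
have c0 : 0 <= c by rewrite fine_ge0// integral_ge0.
have fc : (\int[leb]_(t in D) Phi (k^-1 * Normc.normc (f t))%R <= c%:E)%E.
  by rewrite /c fineK.
set I := (\int[mu]_(z in Cplus R) (Normc.normc (laplace f z) `^ q)%:E)%E.
have I0 : (0 <= I)%E by apply: integral_ge0 => z _; rewrite lee_fin powR_ge0.
have Ile := integral_laplace_le mf k0 c0 fc; rewrite SE -EFinM -/I in Ile.
have normE : Lq_norm q mu (laplace f) = (I `^ q^-1)%E by [].
split.
- by move=> z; exact: (cintegrable_laplace mf k0 c0 fc).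
- split; first exact: cmeasurable_laplace.
  by rewrite normE poweR_lty// (le_lt_trans Ile)// ltry.
rewrite normE.
have bound (r : R) : 0 <= r -> (I <= (r `^ q)%:E)%E -> (I `^ q^-1 <= r%:E)%E.
  move=> r0 Ir; have -> : r%:E = ((r `^ q)%:E `^ q^-1)%E.
    by rewrite poweR_EFin -powRrM mulfV ?lt0r_neq0// powRr1.
  apply: gt0_ler_poweR => //.
  - by rewrite invr_ge0 ltW.
  - by rewrite in_itv/= I0 leey.
  - by rewrite in_itv/= lee_fin powR_ge0 leey.
move: M0; rewrite le_eqVlt => /predU1P[M0|M0].
  have s0 : s = 0.
    have := Mq; rewrite -M0 powR0 ?lt0r_neq0// => /esym/eqP.
    by rewrite mulf_eq0 (gt_eqF K0)/= => /eqP.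
  rewrite -M0 mul0e; apply: bound => //.
  by rewrite powR0 ?lt0r_neq0//; move: Ile; rewrite s0 mulr0.
rewrite -lee_pdivrMl//; apply/ereal_infP => _ [j [j0 jP] <-].
rewrite lee_pdivrMl// -EFinM; apply: bound; first by rewrite mulr_ge0// ltW.
have := integral_laplace_le mf j0 ler01 jP; rewrite SE -EFinM -/I => /le_trans; apply.
rewrite lee_fin powRM ?(ltW j0) ?(ltW M0)// Mq /K le_eqVlt; apply/orP; left; apply/eqP.
by rewrite (_ : 1 + 1 = 2)//; ring.
Qed.

End assembly.

Theorem theorem2p6 (R : realType) (q : R) (hq : 2 <= q) :
  exists2 K : R, 0 < K &
    forall (Phi Phit : young_function R)
           (mu : {measure set (R * R) -> \bar R}),
      (forall t : R, 0 <= t -> Phi t = Phit (t `^ (q / (q - 1)))) ->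
      regular_on_Cplus mu ->
      (laplace_opnorm Phi q mu `^ q <=
        K%:E * \esum_(n in [set: int])
          (((2 ^ n)%:E *
             orlicz_norm (complementary Phit) `]0%R, +oo[
               (exp_dyadic (q / (q - 1)) n)) `^ (q - 1) *
           carleson_const q (strip_restr mu n)))%E.
Proof.
exists (strip_const q * 2 `^ (q - 1)).
  by rewrite mulr_gt0 ?powR_gt0// strip_const_gt0.
by move=> Phi Phit mu PhiE _; exact: laplace_opnorm_le.
Qed.
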